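(* There is a constant $k>0$ such that the following holds. Let $\Sigma$ be a compact Riemann surface with conformal metric $h$ of curvature $-1$, $U$ a holomorphic cubic differential on $\Sigma$ and $u$ a small solution to $$\Delta u-16\|U\|_h^2e^{-2u}-2e^u+2=0,$$ and let $[f]:\tilde\Sigma\to\mathbb{CH}^2$ be the associated minimal Lagrangian immersion of the universal cover. If $\|U\|_h<k$ on $\Sigma$, then $[f]$ is proper.
   Context: If locally $h=\gamma|dz|^2$ and $U=Q\,dz^3$, then $\|U\|_h^2=|Q|^2/\gamma^3$, and $\Delta=\frac4\gamma\partial_z\partial_{\bar z}$. A function $u$ on $\Sigma$ is small if $u\ge\frac13\log(16\max_\Sigma\|U\|_h^2)$ (no constraint when $U=0$). On $\mathbb C^3$ let $\langle u,v\rangle=u_1\bar v_1+u_2\bar v_2-u_3\bar v_3$, $W_-=\{u:\langle u,u\rangle<0\}$, $\mathbb{CH}^2=\mathbb PW_-\subset\mathbb{CP}^2$. Associated immersion: identify $\tilde\Sigma$ with the Poincaré disc (or upper half plane) with coordinate $z$; write $e^uh=2s^2|dz|^2$ ($s>0$), $U=Q\,dz^3$ and $\alpha=A\,dz+B\,d\bar z$ with $$A=\begin{pmatrix}s^{-1}s_z & 0 & s \\ -Qs^{-2} & -s^{-1}s_z & 0 \\ 0 & s & 0\end{pmatrix},\quad B=\begin{pmatrix}-s^{-1}s_{\bar z} & \bar Qs^{-2} & 0 \\ 0 & s^{-1}s_{\bar z} & s \\ s & 0 & 0\end{pmatrix}.$$ There is $F:\tilde\Sigma\to SU(2,1)$,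 unique up to left multiplication by a constant, with $F^{-1}dF=\alpha$. Its third column $f$ satisfies $\langle f,f\rangle=-1$, and $[f]$ is the class of $f$ in $\mathbb PW_-$. *)

(* Defs.v *)
From HB Require Import structures.
From mathcomp Require Import all_boot all_order all_algebra.
From mathcomp Require Import all_classical all_reals all_analysis.
From mathcomp Require Import complex.
Import Order.TTheory GRing.Theory Num.Theory.
Import numFieldNormedType.Exports.

Set Implicit Arguments.
Unset Strict Implicit.
Unset Printing Implicit Defensive.

Local Open Scope classical_set_scope.
Local Open Scope ring_scope.
Local Open Scope complex_scope.
Local Open Scope quotient_scope.

Local Notation Re := complex.Re.
Local Notation Im := complex.Im.

(* The usual topology and norm of the complex numbers R[i], inherited from the
   regular module R[i]^o; limits and [derivable] over the field R[i] are then
   the complex ones. *)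
HB.instance Definition _ (R : realType) :=
  PseudoPointedMetric.copy R[i] (R[i])^o.
HB.instance Definition _ (R : realType) := NormedModule.copy R[i] (R[i])^o.

Definition holomorphic_on (R : realType) (D : set R[i]) (f : R[i] -> R[i]) :=
  forall z, D z -> derivable f z 1.

Definition pdx (R : realType) (g : R[i] -> R) (z : R[i]) : R :=
  derive1 (fun t : R => g (t +i* Im z)) (Re z).

Definition pdy (R : realType) (g : R[i] -> R) (z : R[i]) : R :=
  derive1 (fun t : R => g (Re z +i* t)) (Im z).

(* [Cn_on n D g]: g is n times continuously differentiable, in the real sense,
   on the open set D. *)
Fixpoint Cn_on (R : realType) (n : nat) (D : set R[i]) (g : R[i] -> R) : Prop :=
  (forall z, D z -> {for z, continuous g}) /\
  match n with
  | 0%N => True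
  | m.+1 =>
    (forall z, D z -> derivable (fun t : R => g (t +i* Im z)) (Re z) 1 /\
                      derivable (fun t : R => g (Re z +i* t)) (Im z) 1) /\
    Cn_on m D (pdx g) /\ Cn_on m D (pdy g)
  end.

Definition smooth_on (R : realType) (D : set R[i]) (g : R[i] -> R) :=
  forall n, Cn_on n D g.

Definition pdx_c (R : realType) (f : R[i] -> R[i]) (z : R[i]) : R[i] :=
  pdx (fun w => Re (f w)) z +i* pdx (fun w => Im (f w)) z.

Definition pdy_c (R : realType) (f : R[i] -> R[i]) (z : R[i]) : R[i] :=
  pdy (fun w => Re (f w)) z +i* pdy (fun w => Im (f w)) z.

Definition dz (R : realType) (f : R[i] -> R[i]) (z : R[i]) : R[i] :=
  2^-1 * (pdx_c f z - (0 +i* 1) * pdy_c f z).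

Definition dzbar (R : realType) (f : R[i] -> R[i]) (z : R[i]) : R[i] :=
  2^-1 * (pdx_c f z + (0 +i* 1) * pdy_c f z).

(* (4 / gamma) d_z d_zbar g, which is real since g is. *)
Definition laplacian (R : realType) (gamma g : R[i] -> R) (z : R[i]) : R :=
  4 / gamma z * Re (dz (dzbar (fun w => (g w)%:C)) z).

(* Gauss curvature of gamma |dz|^2 *)
Definition gauss_curvature (R : realType) (gamma : R[i] -> R) (z : R[i]) : R :=
  - 2^-1 * laplacian gamma (fun w => ln (gamma w)) z.

(* A holomorphic atlas on S: [chart_map i] is a chart with domain [cdom i] and
   inverse [chart_inv i]; only the values of [chart_map i] on [cdom i] and of
   [chart_inv i] on [chart_map i @` cdom i] are meaningful.  [chart_at p] is some
   chart around p.  Second countability is automatic (Rado). *)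
Record riemannSurface (R : realType) (S : topologicalType) := RiemannSurface {
  chart : Type;
  cdom : chart -> set S;
  chart_map : chart -> S -> R[i];
  chart_inv : chart -> R[i] -> S;
  chart_at : S -> chart;
  rs_hausdorff : hausdorff_space S;
  rs_connected : connected [set: S];
  chart_atP : forall p, cdom (chart_at p) p;
  cdom_open : forall i, open (cdom i);
  cimg_open : forall i, open (chart_map i @` cdom i);
  coordK : forall i p, cdom i p -> chart_inv i (chart_map i p) = p;
  coord_continuous :
    forall i p, cdom i p -> {for p, continuous (chart_map i)};
  param_continuous :
    forall i p, cdom i p -> {for chart_map i p, continuous (chart_inv i)};
  transition_holomorphic : forall i j,
    holomorphic_on (chart_map i @` (cdom i `&` cdom j))
                   (chart_map j \o chart_inv i) }.

Section RiemannSurface.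
Context {R : realType} {S : topologicalType} (X : riemannSurface R S).

Definition cimg (i : chart X) : set R[i] := chart_map i @` cdom i.

(* Derivative, at the image of p, of the change from the chart i to the chart j *)
Definition transition' (i j : chart X) (p : S) : R[i] :=
  derive1 (chart_map j \o chart_inv i) (chart_map i p).

(* In the chart i, the metric is [density i] |dz|^2. *)
Record conformalMetric := ConformalMetric {
  density : chart X -> R[i] -> R;
  density_gt0 : forall i z, cimg i z -> 0 < density i z;
  density_smooth : forall i, smooth_on (cimg i) (density i);
  density_change : forall i j p, cdom i p -> cdom j p ->
    density i (chart_map i p) =
    density j (chart_map j p) * Normc.normc (transition' i j p) ^+ 2 }.

(* In the chart i, the cubic differential is [coef i] dz^3. *)
Record cubicDifferential := CubicDifferential {
  coef : chart X -> R[i] -> R[i];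
  coef_holomorphic : forall i, holomorphic_on (cimg i) (coef i);
  coef_change : forall i j p, cdom i p -> cdom j p ->
    coef i (chart_map i p) = coef j (chart_map j p) * transition' i j p ^+ 3 }.

Definition has_curvature (h : conformalMetric) (c : R) :=
  forall i z, cimg i z -> gauss_curvature (density h i) z = c.

Definition smooth_function (u : S -> R) :=
  forall i, smooth_on (cimg i) (u \o chart_inv i).

(* ||U||_h^2; by the transformation rules any chart around p gives this value. *)
Definition cubic_normsq (h : conformalMetric) (U : cubicDifferential) (p : S)
    : R :=
  let i := chart_at X p in
  let z := chart_map i p in
  Normc.normc (coef U i z) ^+ 2 / density h i z ^+ 3.

Definition cubic_norm (h : conformalMetric) (U : cubicDifferential) (p : S)
    : R := Num.sqrt (cubic_normsq h U p).

Definition is_solution (h : conformalMetric) (U : cubicDifferential)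
    (u : S -> R) :=
  smooth_function u /\
  forall i z, cimg i z ->
    let p := chart_inv i z in
    laplacian (density h i) (u \o chart_inv i) z
      - 16 * cubic_normsq h U p * expR (- 2 * u p) - 2 * expR (u p) + 2 = 0.

(* For S compact the supremum is a maximum. *)
Definition small (h : conformalMetric) (U : cubicDifferential) (u : S -> R) :=
  (exists p, cubic_normsq h U p != 0) ->
  forall p, 3^-1 * ln (16 * sup (range (cubic_normsq h U))) <= u p.

Definition disc : set R[i] := [set z | Normc.normc z < 1].

Definition poincare_density (z : R[i]) : R :=
  4 / (1 - Normc.normc z ^+ 2) ^+ 2.

(* The derivative of the covering cov, read in the chart of S at cov z *)
Definition lift' (cov : R[i] -> S) (z : R[i]) : R[i] :=
  derive1 (chart_map (chart_at X (cov z)) \o cov) z.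

(* The pullback to the disc of h is [lift_density h cov] |dz|^2, and that of U
   is [lift_coef U cov] dz^3. *)
Definition lift_density (h : conformalMetric) (cov : R[i] -> S) (z : R[i])
    : R :=
  let i := chart_at X (cov z) in
  density h i (chart_map i (cov z)) * Normc.normc (lift' cov z) ^+ 2.

Definition lift_coef (U : cubicDifferential) (cov : R[i] -> S) (z : R[i])
    : R[i] :=
  let i := chart_at X (cov z) in
  coef U i (chart_map i (cov z)) * lift' cov z ^+ 3.

(* Over V the sheet [O a] is the image of the continuous section [sigma a]. *)
Definition evenly_covered (cov : R[i] -> S) (V : set S) :=
  exists (I : Type) (O : I -> set R[i]) (sigma : I -> S -> R[i]),
    [/\ disc `&` cov @^-1` V = \bigcup_a O a,
        trivIset [set: I] O &
        forall a,
        [/\ open (O a),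
            forall z, O a z -> sigma a (cov z) = z,
            forall p, V p -> O a (sigma a p) /\ cov (sigma a p) = p &
            forall p, V p -> {for p, continuous (sigma a)}]].

Definition is_covering (cov : R[i] -> S) :=
  [/\ forall z, disc z -> {for z, continuous cov},
      cov @` disc = [set: S] &
      forall p, exists V, [/\ open V, V p & evenly_covered cov V]].

(* cov presents the unit disc, with its Poincare metric, as the universal cover
   of (S, h). *)
Definition is_uniformization (h : conformalMetric) (cov : R[i] -> S) :=
  [/\ is_covering cov,
      forall i : chart X,
        holomorphic_on (disc `&` cov @^-1` cdom i) (chart_map i \o cov) &
      forall z, disc z -> lift_density h cov z = poincare_density z].

End RiemannSurface.

Definition herm (R : realType) (u v : 'cV[R[i]]_3) : R[i] :=
  u 0 0 * (v 0 0)^* + u 1 0 * (v 1 0)^* - u 2 0 * (v 2 0)^*.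

Definition SU21 (R : realType) : set 'M[R[i]]_3 :=
  [set g | \det g = 1 /\ forall u v, herm (g *m u) (g *m v) = herm u v].

Definition Wminus (R : realType) : set 'cV[R[i]]_3 := [set u | herm u u < 0].

Section CH2.
Variable R : realType.

Definition same_line (u v : set_type (@Wminus R)) : bool :=
  `[< exists2 c : R[i], c != 0 & \val u = c *: \val v >].

Lemma same_line_equiv : equiv_class_of same_line.
Proof.
split=> [u|u v|v u w].
- by apply/asboolP; exists 1; rewrite ?oner_eq0 ?scale1r.
- apply/asboolP/asboolP=> -[c c0 e]; exists c^-1; rewrite ?invr_eq0 //.
    by rewrite e scalerA mulVf ?scale1r.
  by rewrite e scalerA mulVf ?scale1r.
- move=> /asboolP[c c0 e] /asboolP[d d0 e']; apply/asboolP.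
  by exists (c * d); rewrite ?mulf_neq0 // e e' scalerA.
Qed.

Canonical same_line_equivRel := EquivRelPack same_line_equiv.

Definition CH2 : Type := quotient_topology {eq_quot same_line}.
HB.instance Definition _ := Topological.on CH2.

Lemma Wminus_delta : (delta_mx 2 0 : 'cV[R[i]]_3) \in @Wminus R.
Proof.
rewrite inE /Wminus /= /herm !mxE /= !mul0r !add0r mul1r conjC1.
by rewrite oppr_lt0 ltr01.
Qed.

(* The class [u] of a vector u of W_-; a junk value when u is not in W_-. *)
Definition proj_class (u : 'cV[R[i]]_3) : CH2 :=
  \pi_(quotient_topology {eq_quot same_line})
    (insubd (SigSub Wminus_delta : set_type (@Wminus R)) u).

End CH2.

Definition proper_on (T T' : topologicalType) (D : set T) (f : T -> T') :=
  forall K : set T', compact K -> compact (D `&` f @^-1` K).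

Definition mx3 (T : nmodType) (rows : seq (seq T)) : 'M[T]_3 :=
  \matrix_(i < 3, j < 3) nth 0 (nth [::] rows i) j.

Section Frame.
Variable R : realType.
Implicit Types (s : R[i] -> R) (Q : R[i] -> R[i]) (z : R[i]).

Definition alphaA s Q z : 'M[R[i]]_3 :=
  let sz := dz (fun w => (s w)%:C) z in
  let c := (s z)%:C in
  mx3 [:: [:: c^-1 * sz;        0;               c];
          [:: - (Q z * c ^- 2); - (c^-1 * sz);   0];
          [:: 0;                c;               0]].

Definition alphaB s Q z : 'M[R[i]]_3 :=
  let szb := dzbar (fun w => (s w)%:C) z in
  let c := (s z)%:C in
  mx3 [:: [:: - (c^-1 * szb);   (Q z)^* * c ^- 2; 0];
          [:: 0;                c^-1 * szb;      c];
          [:: c;                0;               0]].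

(* F maps the disc smoothly to SU(2,1) and
   F^{-1} dF = F^{-1} F_z dz + F^{-1} F_zbar dzbar equals A dz + B dzbar. *)
Definition is_frame s Q (F : R[i] -> 'M[R[i]]_3) :=
  [/\ forall z, disc z -> SU21 (F z),
      forall i j, smooth_on disc (fun w => Re (F w i j)) /\
                  smooth_on disc (fun w => Im (F w i j)),
      forall z, disc z ->
        invmx (F z) *m \matrix_(i, j) dz (fun w => F w i j) z = alphaA s Q z &
      forall z, disc z ->
        invmx (F z) *m \matrix_(i, j) dzbar (fun w => F w i j) z
          = alphaB s Q z].

End Frame.

(* F is a frame of the immersion associated to (h, U, u), in the coordinate z of
   the disc: e^u h = 2 s^2 |dz|^2 with s > 0, U = Q dz^3. *)
Definition associated_frame (R : realType) (S : topologicalType)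
    (X : riemannSurface R S) (h : conformalMetric X) (U : cubicDifferential X)
    (u : S -> R) (cov : R[i] -> S) (F : R[i] -> 'M[R[i]]_3) :=
  is_frame (fun z => Num.sqrt (expR (u (cov z)) * lift_density h cov z / 2))
           (lift_coef U cov) F.

Definition immersion_of_frame (R : realType) (F : R[i] -> 'M[R[i]]_3)
    (z : R[i]) : CH2 R :=
  proj_class (col 2 (F z)).

(* Main.v *)
(* The third row (a0, a1, a2) of the frame satisfies |a2|^2 = 1 + |a0|^2 + |a1|^2,
   and [f] is proper as soon as |a2| tends to infinity at the boundary of the
   disc.  Along a radius in the direction om, put
   p = Re (conj a2 (om a0 + conj om a1)), so that |p| <= 2 |a2|^2.  The structure
   equations give p' = s |om a0 + conj om a1|^2 + 2 s |a2|^2 + error, the error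
   being bounded by 2 |a2|^2 times the sum of |Q| / s^2 and of the angular
   derivative of ln s.  Both are small multiples of s when ||U|| is small: the
   maximum principle on the compact surface puts e^u close to 1, hence ln s close
   to the logarithm of the density of the Poincare metric, which is radial, and
   the Gauss equation together with an interior gradient estimate bounds the
   gradient of the difference.  Therefore p' >= s |a2|^2 >= s, whose integral
   along the radius diverges.  The Gauss equation itself is read off the frame,
   s and its logarithmic derivatives being Hermitian products of columns of F and
   of dF, by commuting the mixed derivatives of F. *)
Require Import Defs.
From mathcomp Require Import all_boot all_order all_algebra.
From mathcomp Require Import all_classical all_reals all_analysis.
From mathcomp Require Import complex.
From mathcomp Require Import ring lra.
Import Order.TTheory GRing.Theory Num.Theory.
Import numFieldNormedType.Exports.

Local Open Scope classical_set_scope.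
Local Open Scope ring_scope.

Set Implicit Arguments.
Unset Strict Implicit.
Unset Printing Implicit Defensive.

Local Open Scope complex_scope.

Local Notation Re := complex.Re.
Local Notation Im := complex.Im.

(** The obstacle is regularity. In the coordinate of the disc [s] is only the square root of an
    expression in the covering and in charts selected point by point, so its derivatives are not
    directly available. The frame has smooth entries by assumption, and this is why [s], d ln s and
    the Gauss equation are extracted from [F] rather than transported from the equation of u on the
    surface. Smallness of u enters at a single place. The inequality that holds at a minimum of u is
    satisfied by e^u near 1 but also by e^u near 0; smallness discards the second range, and s
    becomes comparable with the Poincare density. The radius is the right curve because the radial
    derivative of ln s, comparable with s itself near the boundary, drops out of the structure
    equations along it; only the angular derivative remains, and that one is small. For k = 1/100
    the two errors are at most 88/1000 s and 6/100 s. Doubled, they add up to less than 3/10 s,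
    against a main term 2 s. *)

(** * Derivatives of functions of one real variable and tests at a maximum *)

Section OneVariable.
Context {R : realType}.
Implicit Types (f g : R -> R) (x a b : R).

Lemma is_derive1D f g x a b : is_derive x 1 f a -> is_derive x 1 g b ->
  is_derive x 1 (fun t => f t + g t) (a + b).
Proof. exact: is_deriveD. Qed.

Lemma is_derive1N f x a : is_derive x 1 f a ->
  is_derive x 1 (fun t => - f t) (- a).
Proof. exact: is_deriveN. Qed.

Lemma is_derive1B f g x a b : is_derive x 1 f a -> is_derive x 1 g b ->
  is_derive x 1 (fun t => f t - g t) (a - b).
Proof. exact: is_deriveB. Qed.

Lemma is_derive1M f g x a b : is_derive x 1 f a -> is_derive x 1 g b ->
  is_derive x 1 (fun t => f t * g t) (f x * b + g x * a).
Proof. exact: is_deriveM. Qed.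

Lemma is_derive1_cst (c : R) x : is_derive x 1 (fun _ => c) 0.
Proof. exact: is_derive_cst. Qed.

Lemma is_derive1_id x : is_derive x 1 (fun t : R => t) 1.
Proof. exact: is_derive_id. Qed.

Lemma is_derive1_chain f g x a b : is_derive (g x) 1 f a ->
  is_derive x 1 g b -> is_derive x 1 (fun t => f (g t)) (a * b).
Proof. exact: is_derive1_comp. Qed.

Lemma is_derive1_local f g x a e : 0 < e ->
  (forall t, `|t - x| < e -> f t = g t) ->
  is_derive x 1 f a -> is_derive x 1 g a.
Proof.
move=> e0 efg; apply: near_eq_is_derive; exists e => //= t.
by rewrite /ball_ /= distrC => /efg.
Qed.

Lemma mean_value f (f' : R -> R) a b : a < b ->
  (forall x, a <= x <= b -> is_derive x 1 f (f' x)) ->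
  exists2 c, a < c < b & f b - f a = f' c * (b - a).
Proof.
move=> ab df; have [||c cab e] := @MVT _ f f' _ _ ab.
- by move=> x; rewrite in_itv /= => /andP[/ltW ax /ltW xb]; apply/df/andP.
- apply: derivable_within_continuous => x.
  by rewrite in_itv /= => /df[].
- by exists c => //; move: cab; rewrite in_itv.
Qed.

(** The difference quotients are positive near x. Only the derivative at x is used, so the lemma
    applies to f' in [second_derivative_at_max], known to be differentiable at the maximum alone. *)
Lemma is_derive1_gt0_right f x a : is_derive x 1 f a -> 0 < a ->
  exists2 e, 0 < e & forall t, x < t < x + e -> f x < f t.
Proof.
move=> [df da] a0.
have : (fun h : R => h^-1 *: (f (h *: 1 + x) - f x)) @ 0^' --> a.
  by rewrite -da; exact: df.
move=> /cvgr_gt /(_ _ a0) [e /= e0 he].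
exists e => // t /andP[xt te].
have /= := he (t - x); rewrite sub0r normrN gtr0_norm ?subr_gt0 //.
rewrite ltrBlDl => /(_ te); rewrite subr_eq0 gt_eqF // => /(_ isT).
rewrite scaler1 subrK /GRing.scale /= pmulr_rgt0 ?invr_gt0 ?subr_gt0 //.
Qed.

(** If a > 0, then f' vanishes at x and is positive just to its right, and the mean value theorem
    produces a larger value of f there. *)
Lemma second_derivative_at_max f (f' : R -> R) x a e : 0 < e ->
  (forall t, `|t - x| < e -> is_derive t 1 f (f' t)) ->
  is_derive x 1 f' a -> (forall t, `|t - x| < e -> f t <= f x) -> a <= 0.
Proof.
move=> e0 df d2f fmax; rewrite leNgt; apply/negP => a0.
have f'x0 : f' x = 0.
  have : is_derive x 1 f 0.
    apply: (@derive1_at_max _ f (x - e) (x + e)).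
    - lra.
    - by move=> t; rewrite in_itv /= -ltr_distl => /df[].
    - by rewrite in_itv /= -ltr_distl subrr normr0.
    - by move=> t; rewrite in_itv /= -ltr_distl => /fmax.
  move=> [_ <-]; have [|_ <-] := df x; first by rewrite subrr normr0.
  by [].
have [r r0 hr] := is_derive1_gt0_right d2f a0.
pose h := Num.min e r / 2.
have me : Num.min e r <= e by rewrite ge_min lexx.
have mr : Num.min e r <= r by rewrite ge_min lexx orbT.
have m0 : 0 < Num.min e r by rewrite lt_min e0.
have [||c /andP[xc ch] E] := @mean_value f f' x (x + h).
- by rewrite /h; lra.
- move=> t /andP[t1 t2]; apply: df; rewrite ger0_norm ?subr_ge0 //.
  by rewrite /h in t2; lra.
- have : f' c > 0.
    by rewrite -f'x0; apply: hr; rewrite xc /=; rewrite /h in ch; lra.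
  have : f (x + h) <= f x.
    by apply: fmax; rewrite addrC addKr ger0_norm /h; lra.
  rewrite -subr_le0 E => H f'c; move: H; rewrite pmulr_rle0 //.
  by rewrite /h; lra.
Qed.

(** One-sided, since it serves at a point of the edge of the half square in [gradient_le]. *)
Lemma derive_le0_of_right_max f x a e : 0 < e -> is_derive x 1 f a ->
  (forall t, x < t < x + e -> f t <= f x) -> a <= 0.
Proof.
move=> e0 df fm; rewrite leNgt; apply/negP => a0.
have [r r0 hr] := is_derive1_gt0_right df a0.
pose h := Num.min e r / 2.
have me : Num.min e r <= e by rewrite ge_min lexx.
have mr : Num.min e r <= r by rewrite ge_min lexx orbT.
have m0 : 0 < Num.min e r by rewrite lt_min e0.
have := hr (x + h); have := fm (x + h); rewrite /h.
have -> : x < x + Num.min e r / 2 < x + e by apply/andP; lra.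
have -> : x < x + Num.min e r / 2 < x + r by apply/andP; lra.
by move=> /(_ isT) H /(_ isT); rewrite ltNge H.
Qed.

End OneVariable.

(** * Schwarz's theorem, the maximum principle and an interior gradient estimate on squares *)

Section TwoVariables.
Context {R : realType}.
Implicit Types (G : R -> R -> R) (x y a b c d e h M N : R).

Lemma mixed_difference_mean G (Gx Gxy : R -> R -> R) x y h : 0 < h ->
  (forall s t, x <= s <= x + h -> y <= t <= y + h ->
     is_derive s 1 (G ^~ t) (Gx s t) /\ is_derive t 1 (Gx s) (Gxy s t)) ->
  exists s t, [/\ x < s < x + h, y < t < y + h &
    G (x + h) (y + h) - G (x + h) y - (G x (y + h) - G x y) =
    Gxy s t * h * h].
Proof.
move=> h0 dG.
have y1 : y <= y <= y + h by apply/andP; lra.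
have y2 : y <= y + h <= y + h by apply/andP; lra.
have [||s /andP[s1 s2] E] := @mean_value _ (fun s => G s (y + h) - G s y)
    (fun s => Gx s (y + h) - Gx s y) x (x + h).
- by lra.
- by move=> s sx; apply: is_derive1B; apply (dG s _ sx).
have sx : x <= s <= x + h by apply/andP; lra.
have [||t /andP[t1 t2] E'] := @mean_value _ (Gx s) (Gxy s) y (y + h).
- by lra.
- by move=> t ty; apply (dG s t sx ty).
exists s, t; rewrite s1 s2 t1 t2; split=> //.
have -> : G (x + h) (y + h) - G (x + h) y - (G x (y + h) - G x y) =
  G (x + h) (y + h) - G (x + h) y - G x (y + h) + G x y by ring.
by move: E; rewrite E' => E; lra.
Qed.

(** Schwarz's theorem. The second difference of G over a square of side h is symmetric in the two
    variables, and [mixed_difference_mean] writes it as h^2 times either mixed derivative at some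
    point of the square. The square is taken so small that both mixed derivatives vary by less than
    eps / 2 on it. *)
Lemma mixed_derivatives_eq G (Gx Gy Gxy Gyx : R -> R -> R) x y e : 0 < e ->
  (forall s t, `|s - x| < e -> `|t - y| < e ->
    [/\ is_derive s 1 (G ^~ t) (Gx s t), is_derive t 1 (G s) (Gy s t),
        is_derive t 1 (Gx s) (Gxy s t) & is_derive s 1 (Gy ^~ t) (Gyx s t)]) ->
  {for (x, y), continuous (fun p : R * R => Gxy p.1 p.2)} ->
  {for (x, y), continuous (fun p : R * R => Gyx p.1 p.2)} ->
  Gxy x y = Gyx x y.
Proof.
move=> e0 dG c1 c2; apply/eqP; rewrite -subr_eq0 -normr_le0.
apply/ler_addgt0Pr => eps eps0; rewrite add0r.
have H (F : R -> R -> R) : {for (x, y), continuous (fun p : R * R => F p.1 p.2)} ->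
    exists2 d, 0 < d & forall s t, `|s - x| < d -> `|t - y| < d ->
      `|F s t - F x y| < eps / 2.
  move=> /(@cvgrPdist_lt _ _ _ _ _ (fun p : R * R => F p.1 p.2)) /(_ (eps / 2)).
  case; first by rewrite divr_gt0.
  move=> [A B] /= [[a a0 hA] [b b0 hB] hAB].
  exists (Num.min a b); first by rewrite lt_min a0.
  move=> s t; rewrite !lt_min => /andP[sa sb] /andP[ta tb].
  have /= := hAB (s, t); rewrite distrC; apply.
  by split; [apply: hA|apply: hB]; rewrite /= distrC.
have [d1 d10 h1] := H _ c1; have [d2 d20 h2] := H _ c2.
pose h := Num.min (Num.min d1 d2) e / 2.
have m0 : 0 < Num.min (Num.min d1 d2) e by rewrite !lt_min d10 d20.
have m1 : Num.min (Num.min d1 d2) e <= d1 by rewrite !ge_min lexx.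
have m2 : Num.min (Num.min d1 d2) e <= d2 by rewrite !ge_min lexx orbT.
have m3 : Num.min (Num.min d1 d2) e <= e by rewrite !ge_min lexx orbT.
have h0 : 0 < h by rewrite /h; lra.
have B (a s d : R) : Num.min (Num.min d1 d2) e <= d -> a <= s <= a + h ->
    `|s - a| < d.
  by move=> md /andP[s1]; rewrite /h => s2; rewrite ger0_norm ?subr_ge0 //; lra.
have [|s [t [s1 t1 E1]]] := @mixed_difference_mean G Gx Gxy x y h h0.
  by move=> s t sx ty; have [] := dG s t (B _ _ _ m3 sx) (B _ _ _ m3 ty).
have [|t' [s' [t2 s2 E2]]] :=
    @mixed_difference_mean (fun t s => G s t) (fun t s => Gy s t)
      (fun t s => Gyx s t) y x h h0.
  by move=> t' s' ty sx; have [] := dG s' t' (B _ _ _ m3 sx) (B _ _ _ m3 ty).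
have E : Gxy s t = Gyx s' t'.
  apply: (mulIf (lt0r_neq0 h0)); apply: (mulIf (lt0r_neq0 h0)).
  by rewrite -E1 -E2; ring.
have w (a b : R) : a < b < a + h -> a <= b <= a + h.
  by move=> /andP[/ltW -> /ltW ->].
have := h1 s t (B _ _ _ m1 (w _ _ s1)) (B _ _ _ m1 (w _ _ t1)).
have := h2 s' t' (B _ _ _ m2 (w _ _ s2)) (B _ _ _ m2 (w _ _ t2)).
rewrite E => a2 a1; apply: ltW.
have -> : Gxy x y - Gyx x y =
  (Gyx s' t' - Gyx x y) - (Gyx s' t' - Gxy x y) by ring.
by rewrite (le_lt_trans (ler_normB _ _)) //; lra.
Qed.

Lemma continuous_pair (T U V : topologicalType) (f : T -> U) (g : T -> V) t :
  {for t, continuous f} -> {for t, continuous g} ->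
  {for t, continuous (fun s => (f s, g s))}.
Proof.
move=> cf cg; apply: (@cvg_pair _ _ _ (nbhs t) (nbhs (f t)) (nbhs (g t)));
  [exact: cf|exact: cg].
Qed.

(** At an interior maximum both pure second derivatives are at most 0, against the strict sign of
    their sum. *)
Lemma maximum_principle G (Gx Gy Gxx Gyy : R -> R -> R) a b c d :
  a <= b -> c <= d ->
  (forall x y, a <= x <= b -> c <= y <= d ->
     {for (x, y), continuous (fun p : R * R => G p.1 p.2)}) ->
  (forall x y, a < x < b -> c < y < d ->
    [/\ is_derive x 1 (G ^~ y) (Gx x y), is_derive y 1 (G x) (Gy x y),
        is_derive x 1 (Gx ^~ y) (Gxx x y), is_derive y 1 (Gy x) (Gyy x y) &
        0 < Gxx x y + Gyy x y]) ->
  (forall x y, a <= x <= b -> c <= y <= d ->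
     [|| x == a, x == b, y == c | y == d] -> G x y <= 0) ->
  forall x y, a <= x <= b -> c <= y <= d -> G x y <= 0.
Proof.
move=> ab cd cG dG bG x y xab ycd.
pose A : set (R * R) := `[a, b]%classic `*` `[c, d]%classic.
have AE p : A p <-> a <= p.1 <= b /\ c <= p.2 <= d.
  by rewrite /A /setX /= !in_itv.
have [|||p pA pmax] := @compact_EVT_max _ R (fun p : R * R => G p.1 p.2) A.
- by exists (x, y); apply/AE.
- by apply: compact_setX; exact: segment_compact.
- apply: continuous_in_subspaceT => -[s t] /set_mem/AE /= [? ?].
  exact: cG.
move/set_mem/AE : pA => [p1 p2].
have xyp : G x y <= G p.1 p.2 by apply: (pmax (x, y)); apply/mem_set/AE.
apply: (le_trans xyp).
have [/bG -> //|] := boolP [|| p.1 == a, p.1 == b, p.2 == c | p.2 == d].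
rewrite !negb_or => /and4P[n1 n2 n3 n4].
have q1 : a < p.1 < b by rewrite !lt_neqAle n2 eq_sym n1.
have q2 : c < p.2 < d by rewrite !lt_neqAle n4 eq_sym n3.
pose e := Num.min (Num.min (p.1 - a) (b - p.1)) (Num.min (p.2 - c) (d - p.2)).
have e0 : 0 < e by rewrite !lt_min !subr_gt0 q1.
have e1 : e <= p.1 - a by rewrite !ge_min lexx.
have e2 : e <= b - p.1 by rewrite !ge_min lexx !orbT.
have e3 : e <= p.2 - c by rewrite !ge_min lexx !orbT.
have e4 : e <= d - p.2 by rewrite !ge_min lexx !orbT.
have f1 s : `|s - p.1| < e -> a < s < b.
  by rewrite ltr_distl => /andP[? ?]; apply/andP; lra.
have f2 s : `|s - p.2| < e -> c < s < d.
  by rewrite ltr_distl => /andP[? ?]; apply/andP; lra.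
have w (u v z : R) : u < v < z -> u <= v <= z by move=> /andP[/ltW -> /ltW ->].
have [_ _ dxx dyy L0] := dG _ _ q1 q2.
have X : Gxx p.1 p.2 <= 0.
  apply: (@second_derivative_at_max _ (G ^~ p.2) (Gx ^~ p.2) p.1 _ e e0) => //.
    by move=> t /f1 tab; have [] := dG t p.2 tab q2.
  by move=> t /f1 tab; apply: (pmax (t, p.2)); apply/mem_set/AE; split => //=; apply: w.
have Y : Gyy p.1 p.2 <= 0.
  apply: (@second_derivative_at_max _ (G p.1) (Gy p.1) p.2 _ e e0) => //.
    by move=> t /f2 tab; have [] := dG p.1 t q1 tab.
  by move=> t /f2 tab; apply: (pmax (p.1, t)); apply/mem_set/AE; split => //=; apply: w.
by lra.
Qed.

(** The bound on a + b is strict because [maximum_principle] asks for a strict sign. Only the sum is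
    bounded: it is what the Gauss equation controls. *)
Definition laplacian_bounded G (Gx Gy : R -> R -> R) x0 y0 d M N :=
  forall x y, `|x - x0| <= d -> `|y - y0| <= d ->
  [/\ {for (x, y), continuous (fun p : R * R => G p.1 p.2)},
      `|G x y| <= M,
      is_derive x 1 (G ^~ y) (Gx x y), is_derive y 1 (G x) (Gy x y) &
      exists a b, [/\ is_derive x 1 (Gx ^~ y) a, is_derive y 1 (Gy x) b &
                      `|a + b| < N]].

Lemma laplacian_bounded_derive G Gx Gy x0 y0 d M N x y :
  laplacian_bounded G Gx Gy x0 y0 d M N -> `|x - x0| <= d -> `|y - y0| <= d ->
  [/\ is_derive x 1 (Gx ^~ y) (derive1 (Gx ^~ y) x),
      is_derive y 1 (Gy x) (derive1 (Gy x) y) &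
      `|derive1 (Gx ^~ y) x + derive1 (Gy x) y| < N].
Proof.
move=> LB xd yd; have [_ _ _ _ [a [b [da db abN]]]] := LB x y xd yd.
have ea : derive1 (Gx ^~ y) x = a by rewrite derive1E; apply: derive_val.
have eb : derive1 (Gy x) y = b by rewrite derive1E; apply: derive_val.
by rewrite ea eb.
Qed.

(* The barrier of Gilbarg-Trudinger, Section 3.4, compared on half of the square
   with the part of G that is odd in x - x0. *)
Lemma gradient_le G Gx Gy x0 y0 d M N : 0 < d ->
  laplacian_bounded G Gx Gy x0 y0 d M N ->
  Gx x0 y0 <= 2 * M / d + N * d / 2.
Proof.
move=> d0 LB.
have d'0 : d != 0 by rewrite gt_eqF.
(* The barrier on 0 <= x <= d, |y| <= d. Its first term is harmonic, nonnegative on x = 0 and at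
   least M on the three other sides; its second is nonnegative with Laplacian -N, which outweighs
   the Laplacian of the odd part of G. Its x-derivative at the origin is the bound to be proved. *)
pose psi x y : R := M / d ^+ 2 * (y * y + 2 * d * x - x * x) + N / 2 * (x * (d - x)).
pose W x y : R := (G (x0 + x) (y0 + y) - G (x0 - x) (y0 + y)) / 2 - psi x y.
pose Wx x y : R := (Gx (x0 + x) (y0 + y) + Gx (x0 - x) (y0 + y)) / 2 -
  (M / d ^+ 2 * (2 * d - 2 * x) + N / 2 * (d - 2 * x)).
pose Wy x y : R := (Gy (x0 + x) (y0 + y) - Gy (x0 - x) (y0 + y)) / 2 -
  M / d ^+ 2 * (2 * y).
pose Lx x y : R := derive1 (Gx ^~ y) x.
pose Ly x y : R := derive1 (Gy x) y.
pose Wxx x y : R := (Lx (x0 + x) (y0 + y) - Lx (x0 - x) (y0 + y)) / 2 +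
  M / d ^+ 2 * 2 + N / 2 * 2.
pose Wyy x y : R := (Ly (x0 + x) (y0 + y) - Ly (x0 - x) (y0 + y)) / 2 -
  M / d ^+ 2 * 2.
have N1 x : 0 <= x <= d -> `|x0 + x - x0| <= d.
  by move=> /andP[? ?]; rewrite addrC addKr ger0_norm.
have N2 x : 0 <= x <= d -> `|x0 - x - x0| <= d.
  by move=> /andP[? ?]; rewrite addrC addKr normrN ger0_norm.
have N3 y : - d <= y <= d -> `|y0 + y - y0| <= d.
  by rewrite addrC addKr ler_norml.
have dshift (a x : R) : is_derive x 1 (fun t : R => a + t) 1.
  by apply: is_derive_eq (is_derive1D (is_derive1_cst a x) (is_derive1_id x)) _;
    rewrite add0r.
have drefl (a x : R) : is_derive x 1 (fun t : R => a - t) (-1).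
  by apply: is_derive_eq (is_derive1B (is_derive1_cst a x) (is_derive1_id x)) _;
    rewrite sub0r.
have dpl (f : R -> R) (a x l : R) : is_derive (a + x) 1 f l ->
    is_derive x 1 (fun t : R => f (a + t)) l.
  move=> df; have := @is_derive1_chain _ f (fun t => a + t) x _ _ df (dshift a x).
  by rewrite mulr1.
have dmi (f : R -> R) (a x l : R) : is_derive (a - x) 1 f l ->
    is_derive x 1 (fun t : R => f (a - t)) (- l).
  move=> df; have := @is_derive1_chain _ f (fun t => a - t) x _ _ df (drefl a x).
  by rewrite mulrN1.
have dhalf (f : R -> R) (x l : R) : is_derive x 1 f l ->
    is_derive x 1 (fun t => f t / 2) (l / 2).
  move=> df; apply: is_derive_eq (is_derive1M df (is_derive1_cst _ x)) _.
  by rewrite mulr0 add0r mulrC.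
have dWx x y : 0 <= x <= d -> - d <= y <= d ->
    is_derive x 1 (W ^~ y) (Wx x y).
  move=> xd yd.
  have [_ _ g1 _ _] := LB _ _ (N1 _ xd) (N3 _ yd).
  have [_ _ g2 _ _] := LB _ _ (N2 _ xd) (N3 _ yd).
  rewrite /W /Wx -[Gx (x0 - x) _]opprK.
  apply: is_derive1B.
    by apply: dhalf; apply: is_derive1B; [apply: (dpl (G ^~ _))|apply: (dmi (G ^~ _))].
  by rewrite /psi; apply: is_derive_eq; rewrite /GRing.scale /=; ring.
have dWy x y : 0 <= x <= d -> - d <= y <= d -> is_derive y 1 (W x) (Wy x y).
  move=> xd yd.
  have [_ _ _ g1 _] := LB _ _ (N1 _ xd) (N3 _ yd).
  have [_ _ _ g2 _] := LB _ _ (N2 _ xd) (N3 _ yd).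
  rewrite /W /Wy; apply: is_derive1B.
  by rewrite /psi; apply: is_derive_eq; rewrite /GRing.scale /=; ring.
have W_le0 x y : 0 <= x <= d -> - d <= y <= d -> W x y <= 0.
  apply: (@maximum_principle W Wx Wy Wxx Wyy 0 d (- d) d); try lra.
  - move=> {}x {}y xd yd.
    have [c1 _ _ _ _] := LB _ _ (N1 _ xd) (N3 _ yd).
    have [c2 _ _ _ _] := LB _ _ (N2 _ xd) (N3 _ yd).
    have cx : {for (x, y), continuous (fun p : R * R => p.1)} by exact: cvg_fst.
    have cy : {for (x, y), continuous (fun p : R * R => p.2)} by exact: cvg_snd.
    rewrite /W; apply: continuousB; last first.
      apply: continuousD; apply: continuousM; try exact: cst_continuous.
        apply: continuousB; last exact: continuousM.
        apply: continuousD; first exact: continuousM.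
        by apply: continuousM => //; exact: cst_continuous.
      apply: continuousM => //; apply: continuousB => //; exact: cst_continuous.
    apply: continuousM; last exact: cst_continuous.
    apply: continuousB.
    + apply: (@continuous_comp _ _ _ (fun p : R * R => (x0 + p.1, y0 + p.2))
        (fun p : R * R => G p.1 p.2)) => //.
      by apply: continuous_pair; apply: continuousD => //; exact: cst_continuous.
    + apply: (@continuous_comp _ _ _ (fun p : R * R => (x0 - p.1, y0 + p.2))
        (fun p : R * R => G p.1 p.2)) => //.
      by apply: continuous_pair; [apply: continuousB|apply: continuousD] => //;
        exact: cst_continuous.
  - move=> {}x {}y xd' yd'.
    have xd : 0 <= x <= d by case/andP: xd' => /ltW -> /ltW ->.
    have yd : - d <= y <= d by case/andP: yd' => /ltW -> /ltW ->.
    have [l1 l2 l3] := laplacian_bounded_derive LB (N1 _ xd) (N3 _ yd).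
    have [m1 m2 m3] := laplacian_bounded_derive LB (N2 _ xd) (N3 _ yd).
    split; [exact: dWx|exact: dWy| | |].
    + rewrite /Wx; have -> : Wxx x y = (Lx (x0 + x) (y0 + y) + - Lx (x0 - x) (y0 + y)) / 2 -
          (- (M / d ^+ 2 * 2) - N / 2 * 2) by rewrite /Wxx; ring.
      apply: is_derive1B.
        apply: dhalf; apply: is_derive1D; first exact: (dpl (Gx ^~ _)).
        exact: (dmi (Gx ^~ _)).
      by apply: is_derive_eq; rewrite /GRing.scale /=; ring.
    + rewrite /Wy; have -> : Wyy x y = (Ly (x0 + x) (y0 + y) - Ly (x0 - x) (y0 + y)) / 2 -
          M / d ^+ 2 * 2 by rewrite /Wyy; ring.
      apply: is_derive1B.
      by apply: is_derive_eq; rewrite /GRing.scale /=; ring.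
    + rewrite /Wxx /Wyy.
      move: l3 m3; rewrite -/(Lx _ _) -/(Lx _ _) -/(Ly _ _) -/(Ly _ _).
      by rewrite !ltr_norml => /andP[? ?] /andP[? ?]; lra.
  - move=> {}x {}y xd yd E.
    have [_ b1 _ _ _] := LB _ _ (N1 _ xd) (N3 _ yd).
    have [_ b2 _ _ _] := LB _ _ (N2 _ xd) (N3 _ yd).
    have [_ _ l3] := laplacian_bounded_derive LB (N1 _ xd) (N3 _ yd).
    have N0 : 0 <= N by apply: ltW; apply: le_lt_trans l3.
    have M0 : 0 <= M by apply: le_trans b1.
    have D : (G (x0 + x) (y0 + y) - G (x0 - x) (y0 + y)) / 2 <= M.
      by move: b1 b2; rewrite !ler_norml => /andP[? ?] /andP[? ?]; lra.
    have P0 : 0 <= N / 2 * (x * (d - x)).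
      by case/andP: xd => ? ?; rewrite !mulr_ge0 ?subr_ge0 // ?invr_ge0.
    have [x00|x0'] := eqVneq x 0.
      rewrite /W /psi x00 addr0 subr0 subrr mul0r sub0r oppr_le0.
      rewrite !(mulr0, mul0r, addr0, subr0).
      by rewrite mulr_ge0 ?divr_ge0 ?sqr_ge0 // -expr2 sqr_ge0.
    suff P1 : d ^+ 2 <= y * y + 2 * d * x - x * x.
      rewrite /W /psi subr_le0 (le_trans D) //.
      apply: ler_wpDr => //.
      by rewrite -mulrA ler_peMr // mulrC ler_pdivlMr ?exprn_gt0 // mul1r.
    move: E; rewrite (negbTE x0') /= => /or3P[]/eqP e; rewrite ?e.
    + by have := sqr_ge0 y; rewrite !expr2; lra.
    + have : 0 <= x * (2 * d - x) by case/andP: xd => ? ?; apply: mulr_ge0; lra.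
      by rewrite expr2; lra.
    + have : 0 <= x * (2 * d - x) by case/andP: xd => ? ?; apply: mulr_ge0; lra.
      by rewrite expr2; lra.
have z1 : 0 <= (0 : R) <= d by rewrite lexx ltW.
have z2 : - d <= (0 : R) <= d by rewrite oppr_le0 ltW.
(* [W] vanishes at the origin and is at most 0 to its right. [Wx 0 0] is the x-derivative of G at
   the centre minus that of the barrier. *)
have : Wx 0 0 <= 0.
  apply: (derive_le0_of_right_max d0 (dWx 0 0 z1 z2)) => t.
  rewrite add0r => /andP[t0 td].
  have -> : W 0 0 = 0.
    by rewrite /W /psi !addr0 subr0; ring.
  by apply: W_le0 => //; rewrite !ltW.
rewrite /Wx !addr0 subr0 => H.
have e1 : 2 * M / d = M / d ^+ 2 * (2 * d) by field.
rewrite e1; lra.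
Qed.

(** The hypotheses are invariant under G -> -G and under exchange of the coordinates, so the
    one-sided [gradient_le] yields all four inequalities. *)
Lemma gradient_bound G Gx Gy x0 y0 d M N : 0 < d ->
  laplacian_bounded G Gx Gy x0 y0 d M N ->
  `|Gx x0 y0| <= 2 * M / d + N * d / 2 /\ `|Gy x0 y0| <= 2 * M / d + N * d / 2.
Proof.
move=> d0 LB.
have neg H Hx Hy u0 v0 : laplacian_bounded H Hx Hy u0 v0 d M N ->
    laplacian_bounded (fun x y => - H x y) (fun x y => - Hx x y)
      (fun x y => - Hy x y) u0 v0 d M N.
  move=> K x y xd yd; have [c b h1 h2 [p [q [h3 h4 pq]]]] := K x y xd yd.
  split; [exact: continuousN|by rewrite normrN|exact: is_derive1N|
          exact: is_derive1N|].
  exists (- p), (- q); split; [exact: is_derive1N|exact: is_derive1N|].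
  by rewrite -opprD normrN.
have swap : laplacian_bounded (fun x y => G y x) (fun x y => Gy y x)
    (fun x y => Gx y x) y0 x0 d M N.
  move=> x y xd yd; have [c b h1 h2 [p [q [h3 h4 pq]]]] := LB y x yd xd.
  split=> //; last by exists q, p; split=> //; rewrite addrC.
  apply: (@continuous_comp _ _ _ (fun p : R * R => (p.2, p.1))
        (fun p : R * R => G p.1 p.2)) => //.
  by apply: continuous_pair; [exact: cvg_snd|exact: cvg_fst].
split; rewrite ler_norml (gradient_le d0 LB, gradient_le d0 swap) andbT lerNl.
  exact: (gradient_le d0 (neg _ _ _ _ _ LB)).
exact: (gradient_le d0 (neg _ _ _ _ _ swap)).
Qed.

End TwoVariables.

(** * Real calculus on the complex plane and on the disc *)

Section ComplexPlane.
Context {R : realType}.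
Implicit Types (x y : R) (z w : R[i]).

Lemma normcE z : Normc.normc z = Num.sqrt (Re z ^+ 2 + Im z ^+ 2).
Proof. by case: z. Qed.

Lemma normc_sqr z : Normc.normc z ^+ 2 = Re z ^+ 2 + Im z ^+ 2.
Proof. by rewrite normcE sqr_sqrtr // addr_ge0 ?sqr_ge0. Qed.

Lemma normc_ge0 z : 0 <= Normc.normc z.
Proof. by rewrite normcE sqrtr_ge0. Qed.

Lemma normc_leD z : Normc.normc z <= `|Re z| + `|Im z|.
Proof.
rewrite -(@ler_pXn2r _ 2) ?nnegrE ?normc_ge0 ?addr_ge0 //.
rewrite normc_sqr sqrrD !real_normK ?num_real //.
by rewrite addrAC lerDl mulrn_wge0 // mulr_ge0.
Qed.

Lemma normc_normE z : `|z| = (Normc.normc z)%:C.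
Proof. by []. Qed.

Lemma normcD z w : Normc.normc (z + w) <= Normc.normc z + Normc.normc w.
Proof. by have := ler_normD z w; rewrite !normc_normE -rmorphD lecR. Qed.

Lemma normcN z : Normc.normc (- z) = Normc.normc z.
Proof. by case: z => a b; rewrite /= !sqrrN. Qed.

Lemma discE x y : disc (x +i* y) <-> x ^+ 2 + y ^+ 2 < 1.
Proof.
by rewrite /disc /= -[X in _ < X]sqrtr1 ltr_sqrt ?ltr01.
Qed.

(** The norm of [R[i]] takes its values in [R[i]], so the radius of a ball is a positive element of
    [R[i]], that is, a real one; the lemma passes to radii in [R]. *)
Lemma nbhs_normc z (A : set R[i]) :
  nbhs z A <-> exists2 e : R, 0 < e & forall w, Normc.normc (w - z) < e -> A w.
Proof.
split.
  move=> /nbhs_ballP [e /= e0 H]; exists (Re e).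
    by move: e0; rewrite ltcE => /andP[_].
  move=> w hw; apply: H; rewrite /ball /= distrC normc_normE.
  move: e0; rewrite !ltcE /= => /andP[/eqP <- _]; rewrite eqxx //=.
move=> [e e0 H]; apply/nbhs_ballP; exists e%:C => /=; first by rewrite ltcR.
by move=> w; rewrite /ball /= distrC normc_normE ltcR; exact: H.
Qed.

Lemma continuous_complex_pair x y :
  {for (x, y), continuous (fun p : R * R => p.1 +i* p.2)}.
Proof.
move=> A /nbhs_normc [e e0 H].
exists ([set s | `|s - x| < e / 2], [set t | `|t - y| < e / 2]) => /=.
  by split; exists (e / 2); rewrite /= ?divr_gt0 // => t /=; rewrite distrC.
move=> [s t] /= [sx ty]; apply: H.
by apply: le_lt_trans (normc_leD _) _ => /=; lra.
Qed.

Lemma continuous_Re z : {for z, continuous (@complex.Re R)}.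
Proof.
move=> A [e /= e0 H]; apply/nbhs_normc; exists e => // w hw; apply: H => /=.
rewrite distrC -[_ - _]/(Re w + - Re z); apply: le_lt_trans hw.
rewrite normcE; case: z w => [a b] [c d] /=.
by rewrite -sqrtr_sqr ler_sqrt ?lerDl ?addr_ge0 ?sqr_ge0.
Qed.

Lemma continuous_Im z : {for z, continuous (@complex.Im R)}.
Proof.
move=> A [e /= e0 H]; apply/nbhs_normc; exists e => // w hw; apply: H => /=.
rewrite distrC -[_ - _]/(Im w + - Im z); apply: le_lt_trans hw.
rewrite normcE; case: z w => [a b] [c d] /=.
by rewrite -sqrtr_sqr ler_sqrt ?lerDr ?addr_ge0 ?sqr_ge0.
Qed.

Lemma disc_square z : disc z -> exists2 e : R, 0 < e &
  forall s t, `|s - Re z| < e -> `|t - Im z| < e -> disc (s +i* t).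
Proof.
move=> dz; exists ((1 - Normc.normc z) / 2).
  by rewrite divr_gt0 // subr_gt0.
case: z dz => x y; set z := x +i* y => dz s t /= sx ty; rewrite /disc /=.
rewrite -[X in X < _]/(Normc.normc (s +i* t)).
have -> : s +i* t = z + ((s - x) +i* (t - y)).
  by rewrite /z; simpc; rewrite !addrA ![_ + _ - _]addrAC !subrr !add0r.
apply: le_lt_trans (normcD _ _) _.
by have /= := normc_leD ((s - x) +i* (t - y)); lra.
Qed.

Lemma open_disc : open (@disc R).
Proof.
move=> z dz; apply/nbhs_normc; exists (1 - Normc.normc z).
  by rewrite subr_gt0.
move=> w hw; rewrite /disc /= -(subrK z w).
by apply: le_lt_trans (normcD _ _) _; lra.
Qed.

Section Smooth.
Variable D : set R[i].
Implicit Types g : R[i] -> R.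

Lemma smooth_pdx g : smooth_on D g -> smooth_on D (pdx g).
Proof. by move=> sg n; have [_ [_ []]] := sg n.+1. Qed.

Lemma smooth_pdy g : smooth_on D g -> smooth_on D (pdy g).
Proof. by move=> sg n; have [_ [_ []]] := sg n.+1. Qed.

Lemma smooth_continuous g z : smooth_on D g -> D z -> {for z, continuous g}.
Proof. by move=> sg; have [H _] := sg 0; exact: H. Qed.

Lemma is_derive_pdx g x y : smooth_on D g -> D (x +i* y) ->
  is_derive x 1 (fun t => g (t +i* y)) (pdx g (x +i* y)).
Proof.
move=> sg Dz; have [_ [/(_ _ Dz) [dx _] _]] := sg 1.
by rewrite /pdx derive1E; apply/derivableP.
Qed.

Lemma is_derive_pdy g x y : smooth_on D g -> D (x +i* y) ->
  is_derive y 1 (fun t => g (x +i* t)) (pdy g (x +i* y)).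
Proof.
move=> sg Dz; have [_ [/(_ _ Dz) [_ dy] _]] := sg 1.
by rewrite /pdy derive1E; apply/derivableP.
Qed.

End Smooth.

Lemma continuous_on_pairs (g : R[i] -> R) x y :
  {for x +i* y, continuous g} ->
  {for (x, y), continuous (fun p : R * R => g (p.1 +i* p.2))}.
Proof.
move=> cg; apply: (@continuous_comp _ _ _ (fun p : R * R => p.1 +i* p.2) g) => //.
exact: continuous_complex_pair.
Qed.

Lemma pdxy_comm (g : R[i] -> R) z : smooth_on disc g -> disc z ->
  pdy (pdx g) z = pdx (pdy g) z.
Proof.
case: z => x y sg dz; have [e e0 he] := disc_square dz.
apply: (@mixed_derivatives_eq _ (fun s t => g (s +i* t))
  (fun s t => pdx g (s +i* t)) (fun s t => pdy g (s +i* t))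
  (fun s t => pdy (pdx g) (s +i* t)) (fun s t => pdx (pdy g) (s +i* t)) x y e).
- by [].
- move=> s t sx ty; have st := he s t sx ty.
  by split; [apply: is_derive_pdx st|apply: is_derive_pdy st|
    apply: is_derive_pdy st; apply: smooth_pdx|
    apply: is_derive_pdx st; apply: smooth_pdy].
- apply: continuous_on_pairs; apply: (smooth_continuous _ dz).
  exact/smooth_pdy/smooth_pdx.
- apply: continuous_on_pairs; apply: (smooth_continuous _ dz).
  exact/smooth_pdx/smooth_pdy.
Qed.

(** Componentwise, in agreement with [pdx_c] and [pdy_c]: the variable is real while the values are
    complex. *)
Definition is_cderive (x : R) (f : R -> R[i]) (d : R[i]) :=
  is_derive x 1 (fun t => Re (f t)) (Re d) /\
  is_derive x 1 (fun t => Im (f t)) (Im d).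

Lemma is_cderiveD x f g a b : is_cderive x f a -> is_cderive x g b ->
  is_cderive x (fun t => f t + g t) (a + b).
Proof.
have reD (u v : R[i]) : Re (u + v) = Re u + Re v by case: u v => ? ? [].
have imD (u v : R[i]) : Im (u + v) = Im u + Im v by case: u v => ? ? [].
move=> [f1 f2] [g1 g2]; split.
  by under eq_fun do rewrite reD; rewrite reD; exact: is_derive1D.
by under eq_fun do rewrite imD; rewrite imD; exact: is_derive1D.
Qed.

Lemma is_cderiveM x f g a b : is_cderive x f a -> is_cderive x g b ->
  is_cderive x (fun t => f t * g t) (a * g x + f x * b).
Proof.
have reM (u v : R[i]) : Re (u * v) = Re u * Re v - Im u * Im v.
  by case: u v => ? ? [].
have imM (u v : R[i]) : Im (u * v) = Re u * Im v + Im u * Re v.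
  by case: u v => ? ? [].
have reD (u v : R[i]) : Re (u + v) = Re u + Re v by case: u v => ? ? [].
have imD (u v : R[i]) : Im (u + v) = Im u + Im v by case: u v => ? ? [].
move=> [f1 f2] [g1 g2]; split.
  under eq_fun do rewrite reM; rewrite reD !reM.
  by apply: is_derive_eq; rewrite /GRing.scale /=; ring.
under eq_fun do rewrite imM; rewrite imD !imM.
by apply: is_derive_eq; rewrite /GRing.scale /=; ring.
Qed.

Lemma is_cderiveN x f a : is_cderive x f a -> is_cderive x (fun t => - f t) (- a).
Proof.
have reN (u : R[i]) : Re (- u) = - Re u by case: u.
have imN (u : R[i]) : Im (- u) = - Im u by case: u.
move=> [f1 f2]; split.
  by under eq_fun do rewrite reN; rewrite reN; exact: is_derive1N.
by under eq_fun do rewrite imN; rewrite imN; exact: is_derive1N.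
Qed.

Lemma is_cderive_conj x f a : is_cderive x f a ->
  is_cderive x (fun t => Num.conj (f t)) (Num.conj a).
Proof.
have reJ (u : R[i]) : Re (Num.conj u) = Re u by case: u.
have imJ (u : R[i]) : Im (Num.conj u) = - Im u by case: u.
move=> [f1 f2]; split.
  by under eq_fun do rewrite reJ; rewrite reJ.
by under eq_fun do rewrite imJ; rewrite imJ; exact: is_derive1N.
Qed.

Lemma is_cderive_herm x (u v : R -> 'cV[R[i]]_3) (u' v' : 'cV[R[i]]_3) :
  (forall i, is_cderive x (fun t => u t i 0) (u' i 0)) ->
  (forall i, is_cderive x (fun t => v t i 0) (v' i 0)) ->
  is_cderive x (fun t => herm (u t) (v t)) (herm u' (v x) + herm (u x) v').
Proof.
move=> du dv; rewrite /herm.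
have H i := is_cderiveM (du i) (is_cderive_conj (dv i)).
have := is_cderiveD (is_cderiveD (H 0) (H 1)) (is_cderiveN (H 2)).
by congr is_cderive; ring.
Qed.

End ComplexPlane.

(** * The Maurer-Cartan form of the frame in real coordinates *)

Section FrameEquations.
Context {R : realType}.
Implicit Types (x y : R) (z w : R[i]).

Lemma ReD z w : Re (z + w) = Re z + Re w. Proof. by case: z w => ? ? []. Qed.
Lemma ImD z w : Im (z + w) = Im z + Im w. Proof. by case: z w => ? ? []. Qed.
Lemma ReM z w : Re (z * w) = Re z * Re w - Im z * Im w.
Proof. by case: z w => ? ? []. Qed.
Lemma ImM z w : Im (z * w) = Re z * Im w + Im z * Re w.
Proof. by case: z w => ? ? []. Qed.
Lemma ReN z : Re (- z) = - Re z. Proof. by case: z. Qed.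
Lemma ImN z : Im (- z) = - Im z. Proof. by case: z. Qed.
Lemma ReJ z : Re (Num.conj z) = Re z. Proof. by case: z. Qed.
Lemma ImJ z : Im (Num.conj z) = - Im z. Proof. by case: z. Qed.

Definition ReImE := (ReD, ImD, ReM, ImM, ReN, ImN, ReJ, ImJ).

Lemma complex_eqP z w : Re z = Re w -> Im z = Im w -> z = w.
Proof. by case: z w => ? ? [? ?] /= -> ->. Qed.

Lemma i_sqr : ('i%C : R[i]) * 'i%C = -1.
Proof. by rewrite -expr2 sqr_i. Qed.

Lemma dzD_dzbar (f : R[i] -> R[i]) z : dz f z + dzbar f z = pdx_c f z.
Proof. by rewrite /dz /dzbar; field. Qed.

Lemma dzB_dzbar (f : R[i] -> R[i]) z :
  'i%C * (dz f z - dzbar f z) = pdy_c f z.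
Proof.
have -> : 'i%C * (dz f z - dzbar f z) = - ('i%C * 'i%C) * pdy_c f z.
  by rewrite /dz /dzbar; field.
by rewrite i_sqr opprK mul1r.
Qed.

Lemma pdx_c_real (g : R[i] -> R) z : pdx_c (fun w => (g w)%:C) z = (pdx g z)%:C.
Proof. by rewrite /pdx_c /= {2}/pdx derive1_cst. Qed.

Lemma pdy_c_real (g : R[i] -> R) z : pdy_c (fun w => (g w)%:C) z = (pdy g z)%:C.
Proof. by rewrite /pdy_c /= {2}/pdy derive1_cst. Qed.

Variables (s : R[i] -> R) (Q : R[i] -> R[i]) (F : R[i] -> 'M[R[i]]_3).
Hypothesis frameF : is_frame s Q F.

Let q z : R[i] := Q z * (s z)%:C ^- 2.

(** [connection_x] and [connection_y] are the coefficients A + B of dx and i (A - B) of dy in alpha.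
    Their diagonal entries carry the derivatives of ln s. *)
Definition connection_x z : 'M[R[i]]_3 :=
  mx3 [:: [:: 0 +i* - (pdy s z / s z); Num.conj (q z); (s z)%:C];
          [:: - q z; 0 +i* (pdy s z / s z); (s z)%:C];
          [:: (s z)%:C; (s z)%:C; 0]].

Definition connection_y z : 'M[R[i]]_3 :=
  mx3 [:: [:: 0 +i* (pdx s z / s z); - 'i%C * Num.conj (q z); 0 +i* s z];
          [:: - 'i%C * q z; 0 +i* - (pdx s z / s z); 0 +i* - s z];
          [:: 0 +i* - s z; 0 +i* s z; 0]].

Definition frame_x z : 'M[R[i]]_3 := \matrix_(i, j) pdx_c (fun w => F w i j) z.
Definition frame_y z : 'M[R[i]]_3 := \matrix_(i, j) pdy_c (fun w => F w i j) z.

Lemma conj_real_quot (u : R[i]) x : Num.conj (u * x%:C ^- 2) = Num.conj u * x%:C ^- 2.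
Proof.
rewrite -rmorphXn -fmorphV; apply: complex_eqP; rewrite !ReImE /=; ring.
Qed.

Lemma alpha_sum z : alphaA s Q z + alphaB s Q z = connection_x z.
Proof.
set c := (s z)%:C.
have cV : c^-1 = ((s z)^-1)%:C by rewrite /c fmorphV.
have E : c^-1 * dz (fun w => (s w)%:C) z - c^-1 * dzbar (fun w => (s w)%:C) z
    = 0 +i* - (pdy s z / s z).
  (* The factor -i^2 = 1 supplies the i required by [dzB_dzbar]. *)
  have -> : c^-1 * dz (fun w => (s w)%:C) z - c^-1 * dzbar (fun w => (s w)%:C) z
     = - ('i%C * 'i%C) * (c^-1 * (dz (fun w => (s w)%:C) z - dzbar (fun w => (s w)%:C) z)).
    by rewrite i_sqr; ring.
  have -> : - ('i%C * 'i%C) * (c^-1 * (dz (fun w => (s w)%:C) z - dzbar (fun w => (s w)%:C) z))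
    = - ('i%C * c^-1 * ('i%C * (dz (fun w => (s w)%:C) z - dzbar (fun w => (s w)%:C) z))).
    by ring.
  rewrite dzB_dzbar pdy_c_real cV.
  by apply: complex_eqP; rewrite !ReImE /=; ring.
apply/matrixP => i j; rewrite !mxE.
case: i => [[|[|[|//]]] hi]; case: j => [[|[|[|//]]] hj] /=;
  rewrite -?/c ?addr0 ?add0r //.
- by rewrite /q conj_real_quot.
- apply: oppr_inj; transitivity (0 +i* - (pdy s z / s z)).
    by rewrite -E; ring.
  by apply: complex_eqP; rewrite !ReImE /=; ring.
Qed.

Lemma alpha_diff z : 'i%C *: (alphaA s Q z - alphaB s Q z) = connection_y z.
Proof.
set c := (s z)%:C.
have cV : c^-1 = ((s z)^-1)%:C by rewrite /c fmorphV.
have E : 'i%C * (c^-1 * dz (fun w => (s w)%:C) z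
      + c^-1 * dzbar (fun w => (s w)%:C) z) = 0 +i* (pdx s z / s z).
  rewrite -mulrDr dzD_dzbar pdx_c_real cV.
  by apply: complex_eqP; rewrite !ReImE /=; ring.
have ic : 'i%C * c = 0 +i* s z by apply: complex_eqP; rewrite !ReImE /=; ring.
apply/matrixP => i j; rewrite !mxE.
case: i => [[|[|[|//]]] hi]; case: j => [[|[|[|//]]] hj] /=;
  rewrite -?/c ?subr0 ?sub0r ?opprK ?mulr0 //.
- by rewrite /q conj_real_quot mulNr mulrN.
- by rewrite /q mulNr mulrN.
- transitivity (- (0 +i* (pdx s z / s z))); first by rewrite -E; ring.
  by apply: complex_eqP; rewrite !ReImE /=; ring.
- by rewrite mulrN ic; apply: complex_eqP; rewrite !ReImE /=; ring.
- by rewrite mulrN ic; apply: complex_eqP; rewrite !ReImE /=; ring.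
Qed.

Lemma frame_unit z : disc z -> F z \in unitmx.
Proof.
by case: frameF => SU _ _ _ dz; rewrite unitmxE; have [-> _] := SU z dz; exact: unitr1.
Qed.

Lemma frame_xE z : disc z -> frame_x z = F z *m connection_x z.
Proof.
move=> dz; have [_ _ hA hB] := frameF.
rewrite -alpha_sum -hA // -hB // -mulmxDr mulKVmx ?frame_unit //.
by apply/matrixP => i j; rewrite !mxE dzD_dzbar.
Qed.

Lemma frame_yE z : disc z -> frame_y z = F z *m connection_y z.
Proof.
move=> dz; have [_ _ hA hB] := frameF.
rewrite -alpha_diff -hA // -hB // -mulmxBr -scalemxAr mulKVmx ?frame_unit //.
by apply/matrixP => i j; rewrite !mxE dzB_dzbar.
Qed.

(** [F z] preserves the form, so Hermitian products of columns of F and of its derivatives are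
    computed on the connection matrices. *)
Lemma herm_frame z (A B : 'M[R[i]]_3) j k : disc z ->
  herm (col j (F z *m A)) (col k (F z *m B)) = herm (col j A) (col k B).
Proof.
move=> dz; have [SU _ _ _] := frameF; have [_ H] := SU z dz.
by rewrite !colE -!mulmxA H.
Qed.

Lemma herm_frame1 z (A : 'M[R[i]]_3) j k : disc z ->
  herm (col j (F z *m A)) (col k (F z)) = herm (col j A) (col k 1%:M).
Proof. by move=> dz; rewrite -{2}(mulmx1 (F z)) herm_frame. Qed.

Lemma frame_entry_derive i j x y : disc (x +i* y) ->
  is_cderive x (fun t => F (t +i* y) i j) (frame_x (x +i* y) i j) /\
  is_cderive y (fun t => F (x +i* t) i j) (frame_y (x +i* y) i j).
Proof.
move=> dz; have [_ sm _ _] := frameF; have [s1 s2] := sm i j.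
rewrite !mxE; split; split.
- exact: (is_derive_pdx s1 dz).
- exact: (is_derive_pdx s2 dz).
- exact: (is_derive_pdy s1 dz).
- exact: (is_derive_pdy s2 dz).
Qed.

Definition frame_xy z : 'M[R[i]]_3 :=
  \matrix_(i, j) pdy_c (fun w => frame_x w i j) z.

(** Mixed partial derivatives of the smooth entries of F commute, so one matrix serves for both
    derivatives. The terms that contain it cancel in [gauss_equation]. *)
Lemma frame_x_entry_derive i j x y : disc (x +i* y) ->
  is_cderive y (fun t => frame_x (x +i* t) i j) (frame_xy (x +i* y) i j) /\
  is_cderive x (fun t => frame_y (t +i* y) i j) (frame_xy (x +i* y) i j).
Proof.
move=> dz; have [_ sm _ _] := frameF; have [s1 s2] := sm i j.
have t1 := smooth_pdx s1; have t2 := smooth_pdx s2.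
have r1 := smooth_pdy s1; have r2 := smooth_pdy s2.
have fx : (fun w => frame_x w i j) = pdx_c (fun w => F w i j).
  by apply/funext => w; rewrite mxE.
rewrite [frame_xy _ _ _]mxE fx; split; split.
- under eq_fun do rewrite mxE /=.
  exact: (is_derive_pdy t1 dz).
- under eq_fun do rewrite mxE /=.
  exact: (is_derive_pdy t2 dz).
- under eq_fun do rewrite mxE /=.
  rewrite /pdy_c /= (pdxy_comm s1 dz).
  exact: (is_derive_pdx r1 dz).
- under eq_fun do rewrite mxE /=.
  rewrite /pdy_c /= (pdxy_comm s2 dz).
  exact: (is_derive_pdx r2 dz).
Qed.

(** Only existence is recorded: it is what makes [s] differentiable in [scale_derive]. *)
Lemma frame_x_x_derivable i j x y : disc (x +i* y) ->
  (exists d, is_cderive x (fun t => frame_x (t +i* y) i j) d) /\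
  (exists d, is_cderive y (fun t => frame_x (x +i* t) i j) d).
Proof.
move=> dz; have [_ sm _ _] := frameF; have [s1 s2] := sm i j.
have t1 := smooth_pdx s1; have t2 := smooth_pdx s2.
have fx : (fun w => frame_x w i j) = pdx_c (fun w => F w i j).
  by apply/funext => w; rewrite mxE.
split.
  exists (pdx_c (fun w => frame_x w i j) (x +i* y)); rewrite fx.
  split; under eq_fun do rewrite mxE /=.
    exact: (is_derive_pdx t1 dz).
  exact: (is_derive_pdx t2 dz).
exists (pdy_c (fun w => frame_x w i j) (x +i* y)); rewrite fx.
split; under eq_fun do rewrite mxE /=.
  exact: (is_derive_pdy t1 dz).
exact: (is_derive_pdy t2 dz).
Qed.

End FrameEquations.

(** * Regularity of s and the Gauss equation, recovered from the frame *)

Section GaussEquation.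
Context {R : realType}.
Implicit Types (x y : R) (z w : R[i]).
Variables (s : R[i] -> R) (Q : R[i] -> R[i]) (F : R[i] -> 'M[R[i]]_3).
Hypothesis frameF : is_frame s Q F.

Lemma is_derive_disc_local_x (f g : R[i] -> R) x y a : disc (x +i* y) ->
  (forall z, disc z -> f z = g z) ->
  is_derive x 1 (fun t => f (t +i* y)) a -> is_derive x 1 (fun t => g (t +i* y)) a.
Proof.
move=> dz fg; have [e e0 he] := disc_square dz.
apply: (is_derive1_local e0) => t te; apply: fg; apply: he => //=.
by rewrite subrr normr0.
Qed.

Lemma is_derive_disc_local_y (f g : R[i] -> R) x y a : disc (x +i* y) ->
  (forall z, disc z -> f z = g z) ->
  is_derive y 1 (fun t => f (x +i* t)) a -> is_derive y 1 (fun t => g (x +i* t)) a.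
Proof.
move=> dz fg; have [e e0 he] := disc_square dz.
apply: (is_derive1_local e0) => t te; apply: fg; apply: he => //=.
by rewrite subrr normr0.
Qed.

(** Column 2 of [connection_x] is s (1, 1, 0) and the frame is orthonormal. The left side is built
    from entries of F and their first derivatives, whence the regularity of [s]. *)
Lemma scale_eq z : disc z ->
  Re (herm (col 2 (frame_x F z)) (col 0 (F z))) = s z.
Proof.
move=> dz; rewrite (frame_xE frameF dz) (herm_frame1 frameF _ _ _ dz).
by rewrite /herm !mxE ?(mulr1n, mulr0n) !ReImE /=; ring.
Qed.

Lemma dlog_scale_x z : disc z ->
  Im (herm (col 0 (frame_y F z)) (col 0 (F z))) = pdx s z / s z.
Proof.
move=> dz; rewrite (frame_yE frameF dz) (herm_frame1 frameF _ _ _ dz).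
by rewrite /herm !mxE ?(mulr1n, mulr0n) !ReImE /=; ring.
Qed.

Lemma dlog_scale_y z : disc z ->
  - Im (herm (col 0 (frame_x F z)) (col 0 (F z))) = pdy s z / s z.
Proof.
move=> dz; rewrite (frame_xE frameF dz) (herm_frame1 frameF _ _ _ dz).
by rewrite /herm !mxE ?(mulr1n, mulr0n) !ReImE /=; ring.
Qed.

(** The first components contribute a real number, the second ones i |q|^2 and the third ones,
    through the minus sign of the form, i s^2. *)
Lemma herm_y_x z : disc z ->
  Im (herm (col 0 (frame_y F z)) (col 0 (frame_x F z))) =
  s z ^+ 2 + Normc.normc (Q z * (s z)%:C ^- 2) ^+ 2.
Proof.
move=> dz; rewrite (frame_xE frameF dz) (frame_yE frameF dz).
rewrite (herm_frame frameF _ _ _ _ dz).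
rewrite /herm !mxE /= normc_sqr !ReImE /=.
by ring.
Qed.

Lemma herm_conj_sym (u v : 'cV[R[i]]_3) : Im (herm v u) = - Im (herm u v).
Proof. by rewrite /herm !ReImE; ring. Qed.

(** [pdx] and [pdy] have a default value where the derivative does not exist, so identities about
    [pdx s] do not show that [s] is differentiable. This comes from [scale_eq]. *)
Lemma scale_derive x y : disc (x +i* y) ->
  is_derive x 1 (fun t => s (t +i* y)) (pdx s (x +i* y)) /\
  is_derive y 1 (fun t => s (x +i* t)) (pdy s (x +i* y)).
Proof.
move=> dz.
have key (u : R -> R) (t d : R) : is_derive t 1 u d -> is_derive t 1 u (derive1 u t).
  by move=> du; rewrite derive1E derive_val.
have H i := frame_x_x_derivable frameF i 2 dz.
have G i := frame_entry_derive frameF i 0 dz.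
split; rewrite /pdx /pdy /=.
  have [d hd] : exists d, forall i, is_cderive x (fun t => frame_x F (t +i* y) i 2) (d i).
    (* A derivative is chosen for each of the three entries; the default 0 is never reached. *)
    exists (fun i => xget 0 (fun d => is_cderive x (fun t => frame_x F (t +i* y) i 2) d)).
    by move=> i; have [[d hd] _] := H i; apply: xgetPex; exists d.
  have [dh _] := @is_cderive_herm R x (fun t => col 2 (frame_x F (t +i* y)))
    (fun t => col 0 (F (t +i* y))) (\col_i d i) (col 0 (frame_x F (x +i* y)))
    (fun i => ltac:(under eq_fun do rewrite mxE; rewrite mxE; exact: hd))
    (fun i => ltac:(under eq_fun do rewrite mxE; rewrite mxE; exact: (G i).1)).
  exact: (key _ _ _ (is_derive_disc_local_x
    (f := fun z => Re (herm (col 2 (frame_x F z)) (col 0 (F z)))) dz scale_eq dh)).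
have [d hd] : exists d, forall i, is_cderive y (fun t => frame_x F (x +i* t) i 2) (d i).
  exists (fun i => xget 0 (fun d => is_cderive y (fun t => frame_x F (x +i* t) i 2) d)).
  by move=> i; have [_ [d hd]] := H i; apply: xgetPex; exists d.
have [dh _] := @is_cderive_herm R y (fun t => col 2 (frame_x F (x +i* t)))
  (fun t => col 0 (F (x +i* t))) (\col_i d i) (col 0 (frame_y F (x +i* y)))
  (fun i => ltac:(under eq_fun do rewrite mxE; rewrite mxE; exact: hd))
  (fun i => ltac:(under eq_fun do rewrite mxE; rewrite mxE; exact: (G i).2)).
exact: (key _ _ _ (is_derive_disc_local_y
  (f := fun z => Re (herm (col 2 (frame_x F z)) (col 0 (F z)))) dz scale_eq dh)).
Qed.

Lemma scale_continuous z : disc z -> {for z, continuous s}.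
Proof.
move=> dz.
have E : {near z, (fun w => Re (herm (col 2 (frame_x F w)) (col 0 (F w)))) =1 s}.
  have := open_disc dz; apply: filterS => w; exact: scale_eq.
suff : {for z, continuous (fun w => Re (herm (col 2 (frame_x F w)) (col 0 (F w))))}.
  rewrite /prop_for /continuous_at (scale_eq dz); apply: cvg_trans.
  by apply: (@near_eq_cvg _ _ (nbhs z)); exact: E.
have [_ sm _ _] := frameF.
have cF i : {for z, continuous (fun w => Re (F w i 0))} /\
    {for z, continuous (fun w => Im (F w i 0))}.
  by have [s1 s2] := sm i 0; split; apply: smooth_continuous dz.
have cX i : {for z, continuous (fun w => Re (pdx_c (fun v => F v i 2) w))} /\
    {for z, continuous (fun w => Im (pdx_c (fun v => F v i 2) w))}.
  have [s1 s2] := sm i 2; split.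
    by apply: smooth_continuous dz; exact: smooth_pdx.
  by apply: smooth_continuous dz; exact: smooth_pdx.
have c i : {for z, continuous (fun w => Re (pdx_c (fun v => F v i 2) w) * Re (F w i 0) +
    Im (pdx_c (fun v => F v i 2) w) * Im (F w i 0))}.
  by have [? ?] := cF i; have [? ?] := cX i; apply: continuousD; apply: continuousM.
have -> : (fun w => Re (herm (col 2 (frame_x F w)) (col 0 (F w)))) = fun w =>
    (Re (pdx_c (fun v => F v 0 2) w) * Re (F w 0 0) + Im (pdx_c (fun v => F v 0 2) w) * Im (F w 0 0)) +
    (Re (pdx_c (fun v => F v 1 2) w) * Re (F w 1 0) + Im (pdx_c (fun v => F v 1 2) w) * Im (F w 1 0)) -
    (Re (pdx_c (fun v => F v 2 2) w) * Re (F w 2 0) + Im (pdx_c (fun v => F v 2 2) w) * Im (F w 2 0)).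
  apply/funext => w; rewrite /herm !mxE !ReImE; ring.
by apply: continuousB; [apply: continuousD|].
Qed.

Lemma ImD_subr (u v w : R[i]) (m : R) : Im v = m -> Im w = - m ->
  Im (u + v) - Im (u + w) = 2 * m.
Proof. by move=> vm wm; rewrite !ImD vm wm; ring. Qed.

(** With F_0 the first column, a is the x-derivative of Im <d_y F_0, F_0> and b the y-derivative of
    -Im <d_x F_0, F_0>. In a + b the terms with the mixed second derivative cancel and 2 Im <d_y
    F_0, d_x F_0> is left, which is [herm_y_x]. *)
Lemma gauss_equation x y : disc (x +i* y) -> exists a b,
  [/\ is_derive x 1 (fun t => pdx s (t +i* y) / s (t +i* y)) a,
      is_derive y 1 (fun t => pdy s (x +i* t) / s (x +i* t)) b &
      a + b = 2 * (s (x +i* y) ^+ 2 +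
        Normc.normc (Q (x +i* y) * (s (x +i* y))%:C ^- 2) ^+ 2)].
Proof.
move=> dz; set z := x +i* y.
have H i := frame_x_entry_derive frameF i 0 dz.
have G i := frame_entry_derive frameF i 0 dz.
have [_ dx] := @is_cderive_herm R x (fun t => col 0 (frame_y F (t +i* y)))
  (fun t => col 0 (F (t +i* y))) (col 0 (frame_xy F z)) (col 0 (frame_x F z))
  (fun i => ltac:(under eq_fun do rewrite mxE; rewrite mxE; exact: (H i).2))
  (fun i => ltac:(under eq_fun do rewrite mxE; rewrite mxE; exact: (G i).1)).
have [_ dy] := @is_cderive_herm R y (fun t => col 0 (frame_x F (x +i* t)))
  (fun t => col 0 (F (x +i* t))) (col 0 (frame_xy F z)) (col 0 (frame_y F z))
  (fun i => ltac:(under eq_fun do rewrite mxE; rewrite mxE; exact: (H i).1))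
  (fun i => ltac:(under eq_fun do rewrite mxE; rewrite mxE; exact: (G i).2)).
eexists; eexists; split.
- exact: (is_derive_disc_local_x
    (f := fun z => Im (herm (col 0 (frame_y F z)) (col 0 (F z))))
    dz dlog_scale_x dx).
- exact: (is_derive_disc_local_y
    (f := fun z => - Im (herm (col 0 (frame_x F z)) (col 0 (F z))))
    dz dlog_scale_y (is_derive1N dy)).
- apply: ImD_subr; first exact: herm_y_x.
  by rewrite herm_conj_sym herm_y_x.
Qed.

End GaussEquation.

(** * Comparison of s with the Poincare density *)

Section ConformalFactor.
Context {R : realType}.
Implicit Types (x y c : R) (z w : R[i]).

Lemma is_derive_ln_sub_sqr c x : 0 < c - x * x ->
  is_derive x 1 (fun t => ln (c - t * t)) (- (2 * x) / (c - x * x)).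
Proof.
move=> c0; have h1 := is_derive1_ln c0.
have h2 : is_derive x 1 (fun t : R => c - t * t) (- (2 * x)).
  by apply: is_derive_eq; rewrite /GRing.scale /=; ring.
have := @is_derive1_chain R (@ln R) (fun t => c - t * t) x _ _ h1 h2.
by rewrite mulrC.
Qed.

Lemma is_derive_div_sub_sqr c x : 0 < c - x * x ->
  is_derive x 1 (fun t => t / (c - t * t))
    ((c - x * x)^-1 + 2 * x * x / (c - x * x) ^+ 2).
Proof.
move=> c0.
have h2 : is_derive x 1 (fun t : R => c - t * t) (- (2 * x)).
  by apply: is_derive_eq; rewrite /GRing.scale /=; ring.
have h3 := @is_deriveV _ (fun t : R => c - t * t) x _ _ (lt0r_neq0 c0) h2.
apply: is_derive_eq (is_derive1M (is_derive1_id x) h3) _.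
by rewrite /GRing.scale /=; field; exact: lt0r_neq0.
Qed.

(** From ln (1 + t) <= t with t = 1/a - 1. *)
Lemma ln_ge_neg (a b : R) : 0 < b -> b <= a -> 1 - b^-1 <= ln a.
Proof.
move=> b0 ba; have a0 : 0 < a by exact: lt_le_trans ba.
rewrite -[ln a]opprK -lnV ?posrE // lerNr opprB.
apply: le_trans (_ : a^-1 - 1 <= _); last first.
  by rewrite lerD2r lef_pV2 ?posrE.
have -> : a^-1 = 1 + (a^-1 - 1) by ring.
rewrite [leRHS](_ : _ = a^-1 - 1); last by ring.
by apply: le_ln1Dx; rewrite ltrBrDl subrr invr_gt0.
Qed.

Variables (s : R[i] -> R) (Q : R[i] -> R[i]) (F : R[i] -> 'M[R[i]]_3).
Hypothesis s_gt0 : forall z, disc z -> 0 < s z.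
Hypothesis frameF : is_frame s Q F.
(** In the application the middle term is 2 e^u, by [poincare_scale]. The constant 18/10000 comes
    from [solution_bounds], and 27/10000 below from [lift_coef_bound]. *)
Hypothesis s_bounds : forall x y, disc (x +i* y) ->
  2 * (1 - 18 / 10000) <= (s (x +i* y) * (1 - (x * x + y * y))) ^+ 2 <= 2.
Hypothesis Q_bound : forall z, disc z ->
  Normc.normc (Q z * (s z)%:C ^- 2) ^+ 2 <= 27 / 10000 * s z ^+ 2.

Let lx z := pdx s z / s z.
Let ly z := pdy s z / s z.

(* The logarithm of the ratio of 2 s^2 |dz|^2 to the Poincare metric. *)
Let G x y : R := 2 * ln (s (x +i* y)) + 2 * ln (1 - (x * x + y * y)) - ln 2.
Let Gx x y : R := 2 * lx (x +i* y) - 4 * (x / (1 - (x * x + y * y))).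
Let Gy x y : R := 2 * ly (x +i* y) - 4 * (y / (1 - (x * x + y * y))).

Lemma disc_gt0 x y : disc (x +i* y) -> 0 < 1 - (x * x + y * y).
Proof. by move=> /discE; rewrite !expr2 subr_gt0. Qed.

Lemma logratio_bound x y : disc (x +i* y) -> `|G x y| <= 4 / 1000.
Proof.
move=> dz; have r0 := disc_gt0 dz; have s0 := s_gt0 dz.
have P0 := mulr_gt0 s0 r0; have := s_bounds dz.
set P := s _ * _ in P0 * => /andP[P1 P2].
have PP : 0 < P ^+ 2 / 2 by rewrite divr_gt0 ?exprn_gt0.
have -> : G x y = ln (P ^+ 2 / 2).
  rewrite /G ln_div ?posrE ?exprn_gt0 // lnXn // mulr2n.
  by rewrite /P lnM ?posrE //; ring.
rewrite ler_norml; apply/andP; split; last first.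
  apply: (@le_trans _ _ 0); last by lra.
  by apply: ln_le0; lra.
apply: le_trans (@ln_ge_neg _ (1 - 18 / 10000) _ _); try lra.
rewrite lerBrDr -lerBrDl opprK.
have -> : (1 - 18 / 10000 : R)^-1 = 10000 / 9982 by field.
by lra.
Qed.

Lemma logratio_derive x y : disc (x +i* y) ->
  is_derive x 1 (G ^~ y) (Gx x y) /\ is_derive y 1 (G x) (Gy x y).
Proof.
move=> dz; have r0 := disc_gt0 dz; have s0 := s_gt0 dz.
have [sx sy] := scale_derive frameF dz.
have chain (u : R -> R) (t d : R) : 0 < u t -> is_derive t 1 u d ->
    is_derive t 1 (fun a => ln (u a)) (d / u t).
  move=> u0 du; have := @is_derive1_chain R (@ln R) u t _ _ (is_derive1_ln u0) du.
  by rewrite mulrC.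
have mul2 (u : R -> R) (t d : R) : is_derive t 1 u d ->
    is_derive t 1 (fun a => 2 * u a) (2 * d).
  move=> du; apply: is_derive_eq (is_derive1M (is_derive1_cst 2 t) du) _.
  by rewrite mulr0 addr0.
have comb (u v : R -> R) (t d d' e : R) : is_derive t 1 u d -> is_derive t 1 v d' ->
    2 * d + 2 * d' = e -> is_derive t 1 (fun a => 2 * u a + 2 * v a - ln 2) e.
  move=> du dv <-.
  apply: is_derive_eq (is_derive1B (is_derive1D (mul2 _ _ _ du) (mul2 _ _ _ dv))
    (is_derive1_cst (ln 2) t)) _.
  by rewrite subr0.
split.
- have e t : 1 - (t * t + y * y) = (1 - y * y) - t * t by ring.
  rewrite /G; apply: (comb _ _ _ _ _ _ (chain (fun t => s (t +i* y)) _ _ s0 sx)).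
    under eq_fun do rewrite e.
    by apply: is_derive_ln_sub_sqr; rewrite -e.
  by rewrite /Gx /lx -e; field; rewrite ?gt_eqF.
- have e t : 1 - (x * x + t * t) = (1 - x * x) - t * t by ring.
  rewrite /G; apply: (comb _ _ _ _ _ _ (chain (fun t => s (x +i* t)) _ _ s0 sy)).
    under eq_fun do rewrite e.
    by apply: is_derive_ln_sub_sqr; rewrite -e.
  by rewrite /Gy /ly -e; field; rewrite ?gt_eqF.
Qed.

Lemma logratio_continuous x y : disc (x +i* y) ->
  {for (x, y), continuous (fun p : R * R => G p.1 p.2)}.
Proof.
move=> dz; have r0 := disc_gt0 dz; have s0 := s_gt0 dz.
have cs := continuous_on_pairs (scale_continuous frameF dz).
have cx : {for (x, y), continuous (fun p : R * R => p.1)} by exact: cvg_fst.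
have cy : {for (x, y), continuous (fun p : R * R => p.2)} by exact: cvg_snd.
rewrite /G; apply: continuousB; last exact: cst_continuous.
apply: continuousD; apply: continuousM; try exact: cst_continuous.
  apply: (@continuous_comp _ _ _ (fun p : R * R => s (p.1 +i* p.2)) (@ln R)) => //.
  by apply: continuous_ln.
apply: (@continuous_comp _ _ _ (fun p : R * R => 1 - (p.1 * p.1 + p.2 * p.2)) (@ln R)).
  apply: continuousB; first exact: cst_continuous.
  by apply: continuousD; apply: continuousM.
by apply: continuous_ln.
Qed.

(** The Laplacian of 2 ln s is 4 (s^2 + |q|^2), that of 2 ln P is -8 / P^2, where P = 1 - |z|^2.
    Times P^2 the sum is 4 s^2 P^2 + 4 |q|^2 P^2 - 8, which lies between -8 * 18/10000 and 8 *
    27/10000 = 216/10000. *)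
Lemma logratio_laplacian x y : disc (x +i* y) -> exists a b,
  [/\ is_derive x 1 (Gx ^~ y) a, is_derive y 1 (Gy x) b &
      `|a + b| * (1 - (x * x + y * y)) ^+ 2 <= 216 / 10000].
Proof.
move=> dz; have r0 := disc_gt0 dz; have s0 := s_gt0 dz.
have [a [b [da db ab]]] := gauss_equation frameF dz.
set P := 1 - (x * x + y * y) in r0 *.
have comb (u v : R -> R) (t d d' : R) : is_derive t 1 u d -> is_derive t 1 v d' ->
    is_derive t 1 (fun a => 2 * u a - 4 * v a) (2 * d - 4 * d').
  move=> du dv; apply: is_derive_eq (is_derive1B
    (is_derive1M (is_derive1_cst 2 t) du) (is_derive1M (is_derive1_cst 4 t) dv)) _.
  by rewrite !mulr0 !addr0.
exists (2 * a - 4 * (P^-1 + 2 * x * x / P ^+ 2)).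
exists (2 * b - 4 * (P^-1 + 2 * y * y / P ^+ 2)); split.
- rewrite /Gx; apply: (comb _ _ _ _ _ da).
  have e t : 1 - (t * t + y * y) = (1 - y * y) - t * t by ring.
  under eq_fun do rewrite e.
  by rewrite /P e; apply: is_derive_div_sub_sqr; rewrite -e.
- rewrite /Gy; apply: (comb _ _ _ _ _ db).
  have e t : 1 - (x * x + t * t) = (1 - x * x) - t * t by ring.
  under eq_fun do rewrite e.
  by rewrite /P e; apply: is_derive_div_sub_sqr; rewrite -e.
have -> : 2 * a - 4 * (P^-1 + 2 * x * x / P ^+ 2) +
   (2 * b - 4 * (P^-1 + 2 * y * y / P ^+ 2)) = 2 * (a + b) - 8 / P ^+ 2.
  have -> : 2 * x * x = 2 * (1 - P - y * y) by rewrite /P; ring.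
  by field; rewrite gt_eqF.
rewrite ab -[X in _ * X]ger0_norm ?sqr_ge0 // -normrM.
have := s_bounds dz; rewrite -/P exprMn => /andP[b1 b2].
have q1 := Q_bound dz; have q0 := sqr_ge0 (Normc.normc (Q (x +i* y) * (s (x +i* y))%:C ^- 2)).
set S := s _ ^+ 2 in b1 b2 q1 *; set q := Normc.normc _ ^+ 2 in q0 q1 *.
have -> : (2 * (2 * (S + q)) - 8 / P ^+ 2) * P ^+ 2 =
    4 * (S * P ^+ 2) + 4 * (q * P ^+ 2) - 8 by field; rewrite gt_eqF.
have h1 : 0 <= q * P ^+ 2 by rewrite mulr_ge0 ?sqr_ge0.
have h2 : q * P ^+ 2 <= 27 / 10000 * (S * P ^+ 2).
  by rewrite (mulrA _ S) ler_wpM2r ?sqr_ge0.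
by rewrite ler_norml; apply/andP; lra.
Qed.

Lemma scale_lower x y : disc (x +i* y) -> 1 <= s (x +i* y) * (1 - (x * x + y * y)).
Proof.
move=> dz; have := mulr_gt0 (s_gt0 dz) (disc_gt0 dz) => h.
have /andP[b1 _] := s_bounds dz.
rewrite -(@ler_pXn2r _ 2) ?nnegrE ?ler01 ?ltW // expr1n; lra.
Qed.

(** The square has size proportional to the distance to the boundary. The Laplacian of G is bounded
    by the inverse square of this size, hence the gradient by its inverse. *)
Lemma logratio_gradient x y : disc (x +i* y) ->
  `|Gx x y| <= 44 / 1000 / (1 - Normc.normc (x +i* y)) /\
  `|Gy x y| <= 44 / 1000 / (1 - Normc.normc (x +i* y)).
Proof.
move=> dz; set r := Normc.normc _; have r1 : 0 < 1 - r by rewrite subr_gt0.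
(* Since r = 1 - 4 d, points of the square of half-side d have modulus at most r + 2 d = 1 - 2 d,
   and 1 - |w|^2 >= 2 d there. *)
pose d := (1 - r) / 4; have d0 : 0 < d by rewrite /d divr_gt0.
have near u v : `|u - x| <= d -> `|v - y| <= d ->
    disc (u +i* v) /\ 2 * d <= 1 - (u * u + v * v).
  move=> ux vy.
  have b : Normc.normc (u +i* v) <= 1 - 2 * d.
    have -> : u +i* v = (x +i* y) + ((u - x) +i* (v - y)).
      by apply: complex_eqP; rewrite !ReImE /=; ring.
    apply: le_trans (normcD _ _) _; rewrite -/r.
    have /= := normc_leD ((u - x) +i* (v - y)).
    by rewrite /d in ux vy *; lra.
  have n0 := normc_ge0 (u +i* v).
  split; first by rewrite /disc /=; apply: le_lt_trans b _; lra.
  have -> : u * u + v * v = Normc.normc (u +i* v) ^+ 2 by rewrite normc_sqr.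
  have : Normc.normc (u +i* v) ^+ 2 <= Normc.normc (u +i* v).
    by rewrite expr2 ler_piMr //; lra.
  lra.
(* 216/10000 over (2 d)^2 is 54/10000 over d^2; rounding up to 6/1000 makes the bound strict. The
   gradient is then at most (8 + 3)/1000 over d, which is 44/1000 over 1 - r. *)
have LB : laplacian_bounded G Gx Gy x y d (4 / 1000) (6 / 1000 / d ^+ 2).
  move=> u v ux vy; have [duv P] := near u v ux vy.
  have [g1 g2] := logratio_derive duv.
  split=> //; [exact: logratio_continuous|exact: logratio_bound|].
  have [a [b [da db ab]]] := logratio_laplacian duv.
  exists a, b; split=> //.
  rewrite ltr_pdivlMr ?exprn_gt0 //.
  have P2 : 4 * d ^+ 2 <= (1 - (u * u + v * v)) ^+ 2.
    have -> : 4 * d ^+ 2 = (2 * d) ^+ 2 by ring.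
    by rewrite ler_pXn2r ?nnegrE //; lra.
  have := ler_wpM2l (normr_ge0 (a + b)) P2; lra.
have [h1 h2] := gradient_bound d0 LB.
have e : 2 * (4 / 1000) / d + 6 / 1000 / d ^+ 2 * d / 2 = 44 / 1000 / (1 - r).
  by rewrite /d; field; rewrite gt_eqF.
by rewrite -e.
Qed.

(* The angular derivative only sees the logarithm of the ratio, the density of
   the Poincare metric being radial. *)
Lemma angular_derivative_bound (r c d : R) : 0 <= r < 1 -> c ^+ 2 + d ^+ 2 = 1 ->
  let z := (r * c) +i* (r * d) in
  `|d * lx z - c * ly z| <= 88 / 1000 * s z /\ 1 <= 2 * (1 - r) * s z.
Proof.
move=> /andP[r0 r1] cd z.
have nz : Normc.normc z = r.
  by rewrite normcE /= !exprMn -mulrDr cd mulr1 sqrtr_sqr ger0_norm.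
have dz : disc z by rewrite -[disc z]/(is_true (Normc.normc z < 1)) nz.
have [g1 g2] : `|Gx (r * c) (r * d)| <= 44 / 1000 / (1 - r) /\
    `|Gy (r * c) (r * d)| <= 44 / 1000 / (1 - r).
  by have := @logratio_gradient (r * c) (r * d) dz; rewrite -[_ +i* _]/z nz.
have c1 : `|c| <= 1.
  by rewrite -(@expr_le1 _ 2) ?normr_ge0 // real_normK ?num_real // -cd lerDl sqr_ge0.
have d1 : `|d| <= 1.
  by rewrite -(@expr_le1 _ 2) ?normr_ge0 // real_normK ?num_real // -cd lerDr sqr_ge0.
have r1' : 0 < 1 - r by rewrite subr_gt0.
have s0 := s_gt0 dz.
(* 1 - r^2 <= 2 (1 - r). This trades 1 / (1 - r) for 2 s and turns 44/1000 into 88/1000. *)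
have sl : 1 <= 2 * (1 - r) * s z.
  apply: le_trans (scale_lower dz) _; rewrite mulrC ler_wpM2r ?(ltW s0) //.
  have -> : r * c * (r * c) + r * d * (r * d) = r ^+ 2 * (c ^+ 2 + d ^+ 2) by ring.
  rewrite cd mulr1; have := sqr_ge0 (1 - r); rewrite !expr2; lra.
split=> //.
have -> : d * lx z - c * ly z = (d * Gx (r * c) (r * d) - c * Gy (r * c) (r * d)) / 2.
  by rewrite /Gx /Gy -/z; set P := (1 - _)^-1; field.
have n1 : `|d * Gx (r * c) (r * d)| <= 44 / 1000 / (1 - r).
  by rewrite normrM; apply: le_trans g1; rewrite ler_piMl.
have n2 : `|c * Gy (r * c) (r * d)| <= 44 / 1000 / (1 - r).
  by rewrite normrM; apply: le_trans g2; rewrite ler_piMl.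
have n3 : 44 / 1000 / (1 - r) <= 88 / 1000 * s z.
  by rewrite ler_pdivrMr //; lra.
rewrite normrM [X in _ * X]ger0_norm ?invr_ge0 //.
have := ler_normB (d * Gx (r * c) (r * d)) (c * Gy (r * c) (r * d)); lra.
Qed.

End ConformalFactor.

(** * Differentiation along a radius *)

Section Rays.
Context {R : realType}.
Implicit Types (x y c d t : R) (z w : R[i]).

(** v may lie on either side of u or coincide with it; the last case occurs when a component of the
    direction is 0. *)
Lemma mean_value_near (f f' : R -> R) (u v : R) :
  (forall x, `|x - u| <= `|v - u| -> is_derive x 1 f (f' x)) ->
  exists2 x, `|x - u| <= `|v - u| & f v - f u = f' x * (v - u).
Proof.
move=> df; have [uv|vu|->] := ltgtP u v; last first.
- by exists v; rewrite // !subrr mulr0.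
- have [|x /andP[x1 x2] E] := @mean_value _ f f' v u vu.
    move=> x /andP[x1 x2]; apply: df.
    by rewrite !ler0_norm; lra.
  exists x; first by rewrite !ler0_norm; lra.
  by apply: oppr_inj; rewrite opprB E -mulrN opprB.
- have [|x /andP[x1 x2] E] := @mean_value _ f f' u v uv.
    move=> x /andP[x1 x2]; apply: df.
    by rewrite !ger0_norm; lra.
  by exists x; first by rewrite !ger0_norm; lra.
Qed.

Lemma is_derive_of_quotient (f : R -> R) x a :
  (forall e, 0 < e -> exists2 r, 0 < r & forall h, h != 0 -> `|h| < r ->
     `|h^-1 * (f (x + h) - f x) - a| <= e) ->
  is_derive x 1 f a.
Proof.
move=> H.
have L : (fun h : R => h^-1 *: ((f \o shift x) (h *: 1) - f x)) @ 0^' --> a.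
  apply/cvgrPdist_le => e e0; have [r r0 hr] := H e e0.
  exists r => //= h; rewrite /= sub0r normrN => hr' h0.
  by rewrite distrC /GRing.scale /= mulr1 addrC [h + x]addrC addrC; apply: hr.
split; first by apply/cvg_ex; exists a; exact: L.
by apply: cvg_lim L.
Qed.

(** The chain rule from partial derivatives: the increment is split into a horizontal and a vertical
    segment, the mean value theorem is applied on each, and continuity of the partial derivatives at
    (x, y) controls the intermediate values. *)
Lemma directional_derivative (G Gx Gy : R -> R -> R) x y e c d :
  `|c| <= 1 -> `|d| <= 1 -> 0 < e ->
  (forall s t, `|s - x| < e -> `|t - y| < e ->
     is_derive s 1 (G ^~ t) (Gx s t) /\ is_derive t 1 (G s) (Gy s t)) ->
  {for (x, y), continuous (fun p : R * R => Gx p.1 p.2)} ->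
  {for (x, y), continuous (fun p : R * R => Gy p.1 p.2)} ->
  forall (u v : R -> R) t0, u t0 = x -> v t0 = y ->
  (forall h, u (t0 + h) = x + h * c) -> (forall h, v (t0 + h) = y + h * d) ->
  is_derive t0 1 (fun t => G (u t) (v t)) (c * Gx x y + d * Gy x y).
Proof.
move=> c1 d1 e0 dG cx cy u v t0 ux vy uh vh.
have K (H : R -> R -> R) r : 0 < r ->
    {for (x, y), continuous (fun p : R * R => H p.1 p.2)} ->
    exists2 b, 0 < b & forall s t, `|s - x| < b -> `|t - y| < b ->
      `|H s t - H x y| <= r.
  move=> r0 /(@cvgrPdist_le _ _ _ _ _ (fun p : R * R => H p.1 p.2)) /(_ r r0).
  move=> [[A B] /= [[a a0 hA] [b b0 hB] hAB]].
  exists (Num.min a b); first by rewrite lt_min a0.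
  move=> s t; rewrite !lt_min => /andP[sa sb] /andP[ta tb].
  have /= := hAB (s, t); rewrite distrC; apply.
  by split; [apply: hA|apply: hB]; rewrite /= distrC.
apply: is_derive_of_quotient => r r0.
have r2 : 0 < r / 2 by rewrite divr_gt0.
have [b1 b10 h1] := K _ _ r2 cx; have [b2 b20 h2] := K _ _ r2 cy.
exists (Num.min (Num.min b1 b2) e); first by rewrite !lt_min b10 b20.
move=> h h0; rewrite !lt_min => /andP[/andP[hb1 hb2] he].
have hc : `|h * c| <= `|h| by rewrite normrM ler_piMr.
have hd : `|h * d| <= `|h| by rewrite normrM ler_piMr.
have n1 s : `|s - x| <= `|x + h * c - x| -> `|s - x| <= `|h|.
  by rewrite [x + _]addrC addrK => /le_trans; apply.
have n2 s : `|s - y| <= `|y + h * d - y| -> `|s - y| <= `|h|.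
  by rewrite [y + _]addrC addrK => /le_trans; apply.
have [|s sx E1] := @mean_value_near (G ^~ (y + h * d)) (Gx ^~ (y + h * d)) x (x + h * c).
  move=> s /n1 sx; apply (dG s (y + h * d) (le_lt_trans sx he)).
  by rewrite addrC addKr; apply: le_lt_trans he.
have [|t ty E2] := @mean_value_near (G x) (Gy x) y (y + h * d).
  move=> t /n2 ty; apply (dG x t) => //; last exact: le_lt_trans he.
  by rewrite subrr normr0.
have g1 : `|Gx s (y + h * d) - Gx x y| <= r / 2.
  apply: h1; first exact: le_lt_trans (n1 _ sx) hb1.
  by rewrite addrC addKr; apply: le_lt_trans hb1.
have g2 : `|Gy x t - Gy x y| <= r / 2.
  apply: h2; last exact: le_lt_trans (n2 _ ty) hb2.
  by rewrite subrr normr0.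
rewrite uh vh ux vy.
have -> : h^-1 * (G (x + h * c) (y + h * d) - G x y) - (c * Gx x y + d * Gy x y) =
    c * (Gx s (y + h * d) - Gx x y) + d * (Gy x t - Gy x y).
  have -> : G (x + h * c) (y + h * d) - G x y =
    Gx s (y + h * d) * (h * c) + Gy x t * (h * d).
    move: E1 E2; rewrite [x + _ - x]addrAC subrr add0r [y + _ - y]addrAC subrr add0r.
    by move=> <- <-; ring.
  by field.
apply: le_trans (ler_normD _ _) _; rewrite !normrM.
have k1 : `|c| * `|Gx s (y + h * d) - Gx x y| <= r / 2.
  by apply: le_trans g1; rewrite ler_piMl.
have k2 : `|d| * `|Gy x t - Gy x y| <= r / 2.
  by apply: le_trans g2; rewrite ler_piMl.
by lra.
Qed.

Lemma is_derive_ray (g : R[i] -> R) c d t : c ^+ 2 + d ^+ 2 = 1 ->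
  smooth_on disc g -> disc ((t * c) +i* (t * d)) ->
  is_derive t 1 (fun r => g ((r * c) +i* (r * d)))
    (c * pdx g ((t * c) +i* (t * d)) + d * pdy g ((t * c) +i* (t * d))).
Proof.
move=> cd sg dz; have [e e0 he] := disc_square dz.
have c1 : `|c| <= 1.
  by rewrite -(@expr_le1 _ 2) ?normr_ge0 // real_normK ?num_real // -cd lerDl sqr_ge0.
have d1 : `|d| <= 1.
  by rewrite -(@expr_le1 _ 2) ?normr_ge0 // real_normK ?num_real // -cd lerDr sqr_ge0.
apply: (@directional_derivative (fun a b => g (a +i* b))
  (fun a b => pdx g (a +i* b)) (fun a b => pdy g (a +i* b)) (t * c) (t * d) e c d
  c1 d1 e0 _ _ _ (fun r => r * c) (fun r => r * d)) => //.
- by move=> a b ax bx; have dab := he a b ax bx; split;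
    [apply: is_derive_pdx dab|apply: is_derive_pdy dab].
- by apply: continuous_on_pairs; apply: smooth_continuous dz; exact: smooth_pdx.
- by apply: continuous_on_pairs; apply: smooth_continuous dz; exact: smooth_pdy.
- by move=> h; rewrite mulrDl.
- by move=> h; rewrite mulrDl.
Qed.

End Rays.

(** * Growth of the last entry of the frame *)

Section Growth.
Context {R : realType}.
Implicit Types (x y c d t : R) (z w : R[i]).

Lemma normc_conj z : Normc.normc (Num.conj z) = Normc.normc z.
Proof. by rewrite !normcE ReJ ImJ sqrrN. Qed.

Lemma Re_le_normc z : `|Re z| <= Normc.normc z.
Proof. by rewrite normcE -sqrtr_sqr ler_wsqrtr // lerDl sqr_ge0. Qed.

Lemma mulc_conj z : Num.conj z * z = (Normc.normc z ^+ 2)%:C.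
Proof. by rewrite normc_sqr; apply: complex_eqP; rewrite !ReImE /=; ring. Qed.

Lemma ord3E (P : 'I_3 -> Prop) : P 0 -> P 1 -> P 2 -> forall i, P i.
Proof.
move=> P0 P1 P2 [[|[|[|//]]] h].
- by have -> : Ordinal h = 0 by apply: val_inj.
- by have -> : Ordinal h = 1 by apply: val_inj.
- by have -> : Ordinal h = 2 by apply: val_inj.
Qed.

Lemma sum_ord3 (f : 'I_3 -> R[i]) : \sum_i f i = f 0 + f 1 + f 2.
Proof.
rewrite 3!big_ord_recr big_ord0 /= add0r.
by congr (f _ + f _ + f _); apply: val_inj.
Qed.

(** Invariance of the form gives relations between columns, which say that J g^T J is a left inverse
    of the conjugate of g, with J = diag(1, 1, -1). A left inverse is a right inverse, and this
    gives the relations between rows. *)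
Lemma SU21_last_row (g : 'M[R[i]]_3) : SU21 g ->
  Normc.normc (g 2 2) ^+ 2 = 1 + Normc.normc (g 2 0) ^+ 2 + Normc.normc (g 2 1) ^+ 2.
Proof.
move=> [_ H].
pose eps (i : 'I_3) : R[i] := if i == 2 then -1 else 1.
have eps0 : eps 0 = 1 by [].
have eps1 : eps 1 = 1 by [].
have eps2 : eps 2 = -1 by [].
pose M : 'M[R[i]]_3 := \matrix_(i, j) (eps i * eps j * g j i).
pose gb : 'M[R[i]]_3 := \matrix_(i, j) Num.conj (g i j).
have E : M *m gb = 1%:M.
  apply/matrixP => j k; rewrite mxE sum_ord3 !mxE.
  have -> : eps j * eps 0 * g 0 j * Num.conj (g 0 k) +
      eps j * eps 1 * g 1 j * Num.conj (g 1 k) +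
      eps j * eps 2 * g 2 j * Num.conj (g 2 k) =
      eps j * herm (g *m delta_mx j 0) (g *m delta_mx k 0).
    by rewrite -!colE /herm !mxE eps0 eps1 eps2; ring.
  rewrite H /herm !mxE; move: j k.
  by apply: ord3E; apply: ord3E => /=;
    rewrite ?(eps0, eps1, eps2, rmorph0, rmorph1); ring.
have := mulmx1C E => /matrixP /(_ 2 2).
rewrite mxE sum_ord3 !mxE eps0 eps1 eps2 => /(congr1 (@complex.Re R)).
have -> : Num.conj (g 2 0) * (1 * -1 * g 2 0) + Num.conj (g 2 1) * (1 * -1 * g 2 1)
  + Num.conj (g 2 2) * (-1 * -1 * g 2 2) =
  - (Num.conj (g 2 0) * g 2 0) - (Num.conj (g 2 1) * g 2 1) + Num.conj (g 2 2) * g 2 2.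
  by ring.
by rewrite !mulc_conj !ReImE /=; lra.
Qed.

Variables (s : R[i] -> R) (Q : R[i] -> R[i]) (F : R[i] -> 'M[R[i]]_3).
Hypothesis s_gt0 : forall z, disc z -> 0 < s z.
Hypothesis frameF : is_frame s Q F.

Lemma real_combination c d z w :
  Re (c%:C * z + d%:C * w) = c * Re z + d * Re w /\
  Im (c%:C * z + d%:C * w) = c * Im z + d * Im w.
Proof. by split; rewrite !ReImE /=; ring. Qed.

Lemma ray_entry_derive j c d t : c ^+ 2 + d ^+ 2 = 1 ->
  disc ((t * c) +i* (t * d)) ->
  is_cderive t (fun r => F ((r * c) +i* (r * d)) 2 j)
    (c%:C * frame_x F ((t * c) +i* (t * d)) 2 j +
     d%:C * frame_y F ((t * c) +i* (t * d)) 2 j).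
Proof.
move=> cd dz; have [_ sm _ _] := frameF; have [s1 s2] := sm 2 j.
rewrite !mxE; split.
  rewrite (real_combination _ _ _ _).1; exact: (is_derive_ray cd s1 dz).
rewrite (real_combination _ _ _ _).2; exact: (is_derive_ray cd s2 dz).
Qed.

(** [l] and [m] stand for the partial derivatives of ln s. Once om is written c + i d, all sides are
    linear in i, so [ring] may treat i as an indeterminate. *)
Lemma ray_algebra (c d l m S : R) (q a0 a1 a2 : R[i]) :
  let om := c +i* d in
  let eta := 0 +i* (d * l - c * m) in
  [/\ c%:C * (a0 * (0 +i* - m) + a1 * (- q) + a2 * S%:C) +
      d%:C * (a0 * (0 +i* l) + a1 * (- 'i%C * q) + a2 * (0 +i* - S)) =
      eta * a0 - om * q * a1 + Num.conj om * S%:C * a2,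
      c%:C * (a0 * Num.conj q + a1 * (0 +i* m) + a2 * S%:C) +
      d%:C * (a0 * (- 'i%C * Num.conj q) + a1 * (0 +i* - l) + a2 * (0 +i* S)) =
      Num.conj om * Num.conj q * a0 - eta * a1 + om * S%:C * a2 &
      c%:C * (a0 * S%:C + a1 * S%:C + a2 * 0) +
      d%:C * (a0 * (0 +i* S) + a1 * (0 +i* - S) + a2 * 0) =
      om * S%:C * a0 + Num.conj om * S%:C * a1].
Proof.
move=> om eta; have iE (a : R) : 0 +i* a = 'i%C * a%:C.
  by apply: complex_eqP; rewrite /= ?mul0r ?mul1r ?mulr0 ?subrr ?add0r.
have omE : om = c%:C + 'i%C * d%:C.
  by rewrite -iE; apply: complex_eqP; rewrite /= ?addr0 ?add0r.
have omJ : Num.conj om = c%:C - 'i%C * d%:C.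
  by rewrite -iE; apply: complex_eqP; rewrite /= ?subr0 ?sub0r.
rewrite omJ omE /eta (iE (- m)) (iE l) (iE (- S)) (iE m) (iE (- l)) (iE S).
rewrite (iE (d * l - c * m)) rmorphB !rmorphM !rmorphN.
by split; ring.
Qed.

(** The third row of F times the connection in the direction (c, d). [eta] is i times the derivative
    of ln s in the orthogonal direction (d, -c). *)
Lemma ray_system c d t : c ^+ 2 + d ^+ 2 = 1 -> disc ((t * c) +i* (t * d)) ->
  let z := (t * c) +i* (t * d) in
  let om := c +i* d in
  let eta := 0 +i* (d * (pdx s z / s z) - c * (pdy s z / s z)) in
  let q := Q z * (s z)%:C ^- 2 in
  let A j r := F ((r * c) +i* (r * d)) 2 j in
  [/\ is_cderive t (A 0) (eta * A 0 t - om * q * A 1 t + Num.conj om * (s z)%:C * A 2 t),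
      is_cderive t (A 1) (Num.conj om * Num.conj q * A 0 t - eta * A 1 t + om * (s z)%:C * A 2 t) &
      is_cderive t (A 2) (om * (s z)%:C * A 0 t + Num.conj om * (s z)%:C * A 1 t)].
Proof.
move=> cd dz z om eta q A.
have H j := ray_entry_derive j cd dz.
have [E0 E1 E2] := ray_algebra c d (pdx s z / s z) (pdy s z / s z) (s z) q
  (A 0 t) (A 1 t) (A 2 t).
rewrite -/om -/eta in E0 E1 E2.
have X j : frame_x F z 2 j = A 0 t * connection_x s Q z 0 j +
    A 1 t * connection_x s Q z 1 j + A 2 t * connection_x s Q z 2 j.
  by rewrite (frame_xE frameF dz) mxE sum_ord3.
have Y j : frame_y F z 2 j = A 0 t * connection_y s Q z 0 j +
    A 1 t * connection_y s Q z 1 j + A 2 t * connection_y s Q z 2 j.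
  by rewrite (frame_yE frameF dz) mxE sum_ord3.
split.
- by rewrite -E0; have := H 0; rewrite -/z X Y !mxE.
- by rewrite -E1; have := H 1; rewrite -/z X Y !mxE.
- by rewrite -E2; have := H 2; rewrite -/z X Y !mxE.
Qed.

(** Since |om| = 1, the two terms in a2 add up to 2 S |a2|^2. The derivative of a2 contributes S
    |X|^2 >= 0, and the rest satisfies |W| <= 2 (88/1000 + 6/100) S |a2| <= 3/10 S |a2|. *)
Lemma flux_derivative_lower (S : R) (om eta q a0 a1 a2 : R[i]) : 0 < S ->
  Normc.normc om = 1 -> Normc.normc eta <= 88 / 1000 * S ->
  Normc.normc q ^+ 2 <= 27 / 10000 * S ^+ 2 ->
  Normc.normc a0 <= Normc.normc a2 -> Normc.normc a1 <= Normc.normc a2 ->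
  S * Normc.normc a2 ^+ 2 <=
  Re (Num.conj (om * S%:C * a0 + Num.conj om * S%:C * a1) *
        (om * a0 + Num.conj om * a1) +
      Num.conj a2 *
        (om * (eta * a0 - om * q * a1 + Num.conj om * S%:C * a2) +
         Num.conj om * (Num.conj om * Num.conj q * a0 - eta * a1 + om * S%:C * a2))).
Proof.
move=> S0 om1 etaS qS a02 a12.
have omom : Num.conj om * om = 1 by rewrite mulc_conj om1 expr1n.
have conjS : Num.conj (S%:C : R[i]) = S%:C.
  by apply: complex_eqP; rewrite ?ReJ ?ImJ /= ?oppr0.
set X := om * a0 + Num.conj om * a1.
pose W := om * (eta * a0 - om * q * a1) +
  Num.conj om * (Num.conj om * Num.conj q * a0 - eta * a1).
have E1 : om * S%:C * a0 + Num.conj om * S%:C * a1 = S%:C * X by rewrite /X; ring.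
have E2 : Num.conj a2 * (om * (eta * a0 - om * q * a1 + Num.conj om * S%:C * a2) +
    Num.conj om * (Num.conj om * Num.conj q * a0 - eta * a1 + om * S%:C * a2)) =
    Num.conj a2 * W + (Num.conj om * om) * (2%:C * S%:C * (Num.conj a2 * a2)).
  by rewrite /W -[2%:C]/((1 + 1)%:C) rmorphD rmorph1; ring.
have conjM (u v : R[i]) : Num.conj (u * v) = Num.conj u * Num.conj v.
  exact: rmorphM.
rewrite E1 E2 omom mul1r conjM conjS -mulrA !mulc_conj -!rmorphM !ReD /=.
have q0 := normc_ge0 q; have b0 := normc_ge0 a2.
have q1 : Normc.normc q <= 6 / 100 * S.
  rewrite -(@ler_pXn2r _ 2) ?nnegrE //; last by lra.
  have := sqr_ge0 S; rewrite exprMn; lra.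
have W1 : Normc.normc W <= 3 / 10 * S * Normc.normc a2.
  have n1 : Normc.normc (om * (eta * a0 - om * q * a1)) <=
      88 / 1000 * S * Normc.normc a2 + 6 / 100 * S * Normc.normc a2.
    rewrite Normc.normcM om1 mul1r; apply: le_trans (normcD _ _) _.
    by rewrite normcN !Normc.normcM om1 mul1r lerD // ler_pM ?normc_ge0.
  have n2 : Normc.normc (Num.conj om * (Num.conj om * Num.conj q * a0 - eta * a1)) <=
      6 / 100 * S * Normc.normc a2 + 88 / 1000 * S * Normc.normc a2.
    rewrite Normc.normcM normc_conj om1 mul1r; apply: le_trans (normcD _ _) _.
    by rewrite normcN !Normc.normcM !normc_conj om1 mul1r lerD // ler_pM ?normc_ge0.
  apply: le_trans (normcD _ _) _.
  by have := mulr_ge0 (ltW S0) b0; lra.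
have W2 : `|Re (Num.conj a2 * W)| <= 3 / 10 * S * Normc.normc a2 ^+ 2.
  apply: le_trans (Re_le_normc _) _; rewrite Normc.normcM normc_conj.
  by have := ler_wpM2l b0 W1; rewrite expr2; lra.
have X0 : 0 <= S * Normc.normc X ^+ 2 by rewrite mulr_ge0 ?sqr_ge0 // ltW.
have A0 : 0 <= S * Normc.normc a2 ^+ 2 by rewrite mulr_ge0 ?sqr_ge0 // ltW.
by move: W2; rewrite ler_norml => /andP[W2 _]; lra.
Qed.

Hypothesis angular : forall r c d : R, 0 <= r < 1 -> c ^+ 2 + d ^+ 2 = 1 ->
  let z := (r * c) +i* (r * d) in
  `|d * (pdx s z / s z) - c * (pdy s z / s z)| <= 88 / 1000 * s z /\
  1 <= 2 * (1 - r) * s z.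
Hypothesis Q_bound : forall z, disc z ->
  Normc.normc (Q z * (s z)%:C ^- 2) ^+ 2 <= 27 / 10000 * s z ^+ 2.

Lemma frame_row_le z : disc z ->
  [/\ 1 <= Normc.normc (F z 2 2) ^+ 2,
      Normc.normc (F z 2 0) <= Normc.normc (F z 2 2) &
      Normc.normc (F z 2 1) <= Normc.normc (F z 2 2)].
Proof.
move=> dz; have [SU _ _ _] := frameF; have E := SU21_last_row (SU z dz).
have := sqr_ge0 (Normc.normc (F z 2 0)); have := sqr_ge0 (Normc.normc (F z 2 1)).
split; first by lra.
  by rewrite -(@ler_pXn2r _ 2) ?nnegrE ?normc_ge0 //; lra.
by rewrite -(@ler_pXn2r _ 2) ?nnegrE ?normc_ge0 //; lra.
Qed.

(* Along a radius p = Re (conj a2 (om a0 + conj om a1)) is half the derivative of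
   |a2|^2 with respect to arc length, and p' >= s |a2|^2 >= s. *)
Lemma last_entry_growth_ray (r c d : R) : 0 <= r < 1 -> c ^+ 2 + d ^+ 2 = 1 ->
  - ln (1 - r) <= 4 * (Normc.normc (F ((r * c) +i* (r * d)) 2 2) ^+ 2 +
    Normc.normc (F 0 2 2) ^+ 2).
Proof.
move=> /andP[r0 r1] cd.
pose om := c +i* d.
pose A j t : R[i] := F ((t * c) +i* (t * d)) 2 j.
have om1 : Normc.normc om = 1 by rewrite normcE /= cd sqrtr1.
pose P t : R[i] := Num.conj (A 2 t) * (om * A 0 t + Num.conj om * A 1 t).
have disct t : 0 <= t < 1 -> disc ((t * c) +i* (t * d)).
  move=> /andP[t0 t1]; apply/discE; rewrite !exprMn -mulrDr cd mulr1.
  by rewrite expr_lt1.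
have P_le t : 0 <= t < 1 -> `|Re (P t)| <= 2 * Normc.normc (A 2 t) ^+ 2.
  move=> t01; have [_ h0 h1] := frame_row_le (disct t t01).
  apply: le_trans (Re_le_normc _) _; rewrite Normc.normcM normc_conj.
  have h : Normc.normc (om * A 0 t + Num.conj om * A 1 t) <= 2 * Normc.normc (A 2 t).
    apply: le_trans (normcD _ _) _; rewrite !Normc.normcM normc_conj om1 !mul1r.
    by rewrite /A; lra.
  by have := ler_wpM2l (normc_ge0 (A 2 t)) h; rewrite expr2; lra.
have cst_d (k : R[i]) t : is_cderive t (fun _ => k) 0.
  by split; exact: is_derive1_cst.
(* The lower bound, whose integral diverges at 1, results from s |a2|^2 >= s and 1 <= 2 (1 - t)
   s. *)
have P_derive t : 0 <= t < 1 -> exists2 b : R, is_derive t 1 (fun t => Re (P t)) b &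
    (2 * (1 - t))^-1 <= b.
  move=> t01; have dz := disct t t01.
  have [d0 d1 d2] := ray_system cd dz.
  have [e1 e2] := angular t01 cd.
  have s0 := s_gt0 dz.
  have [dP _] := is_cderiveM (is_cderive_conj d2) (is_cderiveD
    (is_cderiveM (cst_d om t) d0) (is_cderiveM (cst_d (Num.conj om) t) d1)).
  eexists; first exact: dP.
  have [g1 g2 g3] := frame_row_le dz.
  rewrite !mul0r !add0r.
  apply: le_trans (flux_derivative_lower s0 om1 _ (Q_bound dz) g2 g3).
    have t1 : 0 < 1 - t by rewrite subr_gt0; case/andP: t01.
    rewrite -[X in X <= _]mulr1 ler_pdivrMl ?mulr_gt0 //.
    apply: le_trans e2 _; apply: ler_wpM2l; first by rewrite ltW ?mulr_gt0.
    by apply: ler_peMr => //; exact: ltW.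
  by rewrite normcE /= expr0n /= add0r sqrtr_sqr.
pose D t : R := derive1 (fun t => Re (P t)) t.
have P_D t : 0 <= t < 1 -> 
    [/\ is_derive t 1 (fun t => Re (P t)) (D t) & (2 * (1 - t))^-1 <= D t].
  move=> /P_derive[b db lb].
  by have -> : D t = b by rewrite /D derive1E derive_val.
(* The sign of Re P at the centre is unknown; hence the constant term in the conclusion. *)
have H0 : - (2 * Normc.normc (F 0 2 2) ^+ 2) <= Re (P 0).
  have z0 : (0 +i* 0 : R[i]) = 0 by [].
  have := P_le 0; rewrite lexx ltr01 => /(_ isT).
  by rewrite /A !mul0r z0 ler_norml => /andP[].
have Hr : Re (P r) <= 2 * Normc.normc (A 2 r) ^+ 2.
  have := P_le r; rewrite r0 r1 => /(_ isT).
  by rewrite ler_norml => /andP[].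
suff : - ln (1 - r) / 2 <= Re (P r) - Re (P 0) by rewrite /A in Hr *; lra.
move: r0; rewrite le_eqVlt => /predU1P[<-|r0].
  by rewrite subr0 ln1 oppr0 mul0r subrr.
(* Integration is replaced by monotonicity: Re P + ln (1 - t) / 2 has a nonnegative derivative. *)
have dln t : 0 <= t < 1 -> is_derive t 1 (fun a => Re (P a) + ln (1 - a) / 2)
    (D t - (2 * (1 - t))^-1).
  move=> t01; have [pd _] := P_D t t01.
  have t1 : 0 < 1 - t by rewrite subr_gt0; case/andP: t01.
  have h : is_derive t 1 (fun a : R => 1 - a) (-1).
    by apply: is_derive_eq (is_derive1B (is_derive1_cst 1 t) (is_derive1_id t)) _;
      rewrite sub0r.
  have := @is_derive1_chain R (@ln R) (fun a => 1 - a) t _ _ (is_derive1_ln t1) h.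
  move=> hl; apply: is_derive_eq (is_derive1D pd
    (is_derive1M hl (is_derive1_cst 2^-1 t))) _.
  by field; rewrite gt_eqF.
have [||t /andP[t0 tr] E] := @mean_value R (fun a => Re (P a) + ln (1 - a) / 2)
    (fun t => D t - (2 * (1 - t))^-1) 0 r.
- by [].
- by move=> t /andP[t0 tr]; apply: dln; rewrite t0 /=; exact: le_lt_trans r1.
- have [|_ lb] := P_D t; first by rewrite (ltW t0) /=; exact: lt_trans r1.
  have : 0 <= (D t - (2 * (1 - t))^-1) * (r - 0).
    by rewrite subr0 mulr_ge0 ?subr_ge0 // ltW.
  by rewrite -E subr0 ln1; lra.
Qed.

Lemma last_entry_growth z : disc z ->
  - ln (1 - Normc.normc z) <= 4 * (Normc.normc (F z 2 2) ^+ 2 +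
    Normc.normc (F 0 2 2) ^+ 2).
Proof.
move=> dz; have n0 := normc_ge0 z.
have [c [d [cd zE]]] : exists c d, c ^+ 2 + d ^+ 2 = 1 /\
    z = (Normc.normc z * c) +i* (Normc.normc z * d).
  have [z0|z0] := eqVneq (Normc.normc z) 0.
    (* At the origin any unit direction serves. *)
    exists 1, 0; split; first by rewrite expr1n expr0n addr0.
    by rewrite z0 !mul0r; apply: Normc.eq0_normc.
  exists (Re z / Normc.normc z), (Im z / Normc.normc z); split.
    by rewrite !expr_div_n -mulrDl -normc_sqr divff // expf_neq0.
  by rewrite ![Normc.normc z * _]mulrC !divfK //; case: (z).
rewrite {2}zE; apply: last_entry_growth_ray => //.
by rewrite n0; exact: dz.
Qed.

End Growth.

(** * The maximum principle on the compact surface and its consequences on the disc *)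

Section Surface.
Context {R : realType}.

(** The real part keeps the pure second derivatives only, so no mixed derivatives have to be
    exchanged on D. *)
Lemma laplacianE (D : set R[i]) (gamma v : R[i] -> R) (z : R[i]) :
  smooth_on D v -> D z ->
  laplacian gamma v z = (pdx (pdx v) z + pdy (pdy v) z) / gamma z.
Proof.
case: z => x y sv Dz.
have re w : Re (dzbar (fun w => (v w)%:C) w) = 2^-1 * pdx v w.
  rewrite /dzbar pdx_c_real pdy_c_real; set a := pdx v w; set b := pdy v w.
  have -> : 2^-1 * (a%:C + (0 +i* 1) * b%:C) = (2^-1 * a) +i* (2^-1 * b).
    have -> : (2^-1 : R[i]) = (2^-1)%:C by rewrite fmorphV rmorph_nat.
    by apply: complex_eqP; rewrite !ReImE /=; ring.
  by [].
have im w : Im (dzbar (fun w => (v w)%:C) w) = 2^-1 * pdy v w.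
  rewrite /dzbar pdx_c_real pdy_c_real; set a := pdx v w; set b := pdy v w.
  have -> : 2^-1 * (a%:C + (0 +i* 1) * b%:C) = (2^-1 * a) +i* (2^-1 * b).
    have -> : (2^-1 : R[i]) = (2^-1)%:C by rewrite fmorphV rmorph_nat.
    by apply: complex_eqP; rewrite !ReImE /=; ring.
  by [].
have half (f : R -> R) (t a : R) : is_derive t 1 f a -> derive1 (fun r => 2^-1 * f r) t = 2^-1 * a.
  move=> df; rewrite derive1E.
  have := is_derive1M (is_derive1_cst 2^-1 t) df.
  by rewrite mulr0 addr0 => h; rewrite derive_val.
have X : pdx (fun w => Re (dzbar (fun w => (v w)%:C) w)) (x +i* y) =
    2^-1 * pdx (pdx v) (x +i* y).
  rewrite {1}/pdx; under eq_fun do rewrite re.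
  by apply: half; apply: (is_derive_pdx _ Dz); exact: smooth_pdx.
have Y : pdy (fun w => Im (dzbar (fun w => (v w)%:C) w)) (x +i* y) =
    2^-1 * pdy (pdy v) (x +i* y).
  rewrite {1}/pdy; under eq_fun do rewrite im.
  by apply: half; apply: (is_derive_pdy _ Dz); exact: smooth_pdy.
rewrite /laplacian {1}/dz /pdx_c /pdy_c X Y.
have -> : (2^-1 : R[i]) = (2^-1)%:C by rewrite fmorphV rmorph_nat.
by rewrite !ReImE /=; set g := (gamma _)^-1; field.
Qed.

(** [sg] is 1 at a maximum and -1 at a minimum. *)
Lemma laplacian_at_extremum (sg : R) (D : set R[i]) (gamma v : R[i] -> R) (z : R[i]) :
  open D -> smooth_on D v -> D z -> 0 < gamma z ->
  (forall w, D w -> sg * v w <= sg * v z) -> sg * laplacian gamma v z <= 0.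
Proof.
move=> oD sv Dz g0 ext; rewrite (laplacianE _ sv Dz) mulrA.
rewrite pmulr_lle0 ?invr_gt0 // mulrDr.
case: z Dz g0 ext => x y Dz _ ext.
have /nbhs_normc [e e0 he] : nbhs (x +i* y) D by exact: oD.
have scal (f : R -> R) (t a : R) : is_derive t 1 f a -> is_derive t 1 (fun r => sg * f r) (sg * a).
  by move=> df; have := is_derive1M (is_derive1_cst sg t) df; rewrite mulr0 addr0.
have inx t : `|t - x| < e -> D (t +i* y).
  move=> te; apply: he; apply: le_lt_trans (normc_leD _) _.
  by rewrite ReD ImD /= subrr normr0 addr0.
have iny t : `|t - y| < e -> D (x +i* t).
  move=> te; apply: he; apply: le_lt_trans (normc_leD _) _.
  by rewrite ReD ImD /= subrr normr0 add0r.
have hx : sg * pdx (pdx v) (x +i* y) <= 0.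
  apply: (@second_derivative_at_max R (fun t => sg * v (t +i* y))
    (fun t => sg * pdx v (t +i* y)) x _ e e0).
  - by move=> t /inx Dt; apply/scal/(is_derive_pdx sv Dt).
  - by apply/scal/(is_derive_pdx _ Dz)/smooth_pdx.
  - by move=> t /inx; exact: ext.
have hy : sg * pdy (pdy v) (x +i* y) <= 0.
  apply: (@second_derivative_at_max R (fun t => sg * v (x +i* t))
    (fun t => sg * pdy v (x +i* t)) y _ e e0).
  - by move=> t /iny Dt; apply/scal/(is_derive_pdy sv Dt).
  - by apply/scal/(is_derive_pdy _ Dz)/smooth_pdy.
  - by move=> t /iny; exact: ext.
by lra.
Qed.

Variables (S : topologicalType) (X : riemannSurface R S) (h : conformalMetric X)
  (U : cubicDifferential X) (u : S -> R).

Lemma smooth_function_continuous : smooth_function X u -> continuous u.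
Proof.
move=> su p; pose i := chart_at X p.
have ip : cdom i p by exact: chart_atP.
have E : {near p, u \o chart_inv i \o chart_map i =1 u}.
  have : nbhs p (cdom i) by apply: open_nbhs_nbhs; split=> //; exact: cdom_open.
  by apply: filterS => q iq /=; rewrite coordK.
have c : {for p, continuous (u \o chart_inv i \o chart_map i)}.
  apply: (@continuous_comp _ _ _ (chart_map i) (u \o chart_inv i)).
    exact: Defs.coord_continuous.
  by apply: (smooth_continuous (su i)); exists p.
have e : (u \o chart_inv i \o chart_map i) p = u p by rewrite /= coordK.
move: c; rewrite /prop_for /continuous_at e; apply: cvg_trans.
exact: (@near_eq_cvg _ _ (nbhs p)).
Qed.

Lemma cubic_normsq_ge0 p : 0 <= cubic_normsq h U p.
Proof.
rewrite /cubic_normsq divr_ge0 ?sqr_ge0 // exprn_ge0 // ltW //.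
by apply: density_gt0; exists p => //; exact: chart_atP.
Qed.

Lemma solution_at_extremum (sg : R) p : is_solution h U u ->
  (forall q, sg * u q <= sg * u p) ->
  sg * (16 * cubic_normsq h U p * expR (- 2 * u p) + 2 * expR (u p) - 2) <= 0.
Proof.
move=> [su eq_u] ext; pose i := chart_at X p.
have ip : cdom i p by exact: chart_atP.
have zi : cimg i (chart_map i p) by exists p.
have := eq_u i _ zi; rewrite /= coordK // => E.
have -> : 16 * cubic_normsq h U p * expR (- 2 * u p) + 2 * expR (u p) - 2 =
  laplacian (density h i) (u \o chart_inv i) (chart_map i p) by lra.
apply: (@laplacian_at_extremum sg (cimg i)) => //.
- exact: cimg_open.
- exact: density_gt0.
- by move=> w _; rewrite /= coordK.
Qed.

Lemma cubic_normsq_le : (forall p, cubic_norm h U p < 1 / 100) ->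
  forall p, cubic_normsq h U p <= 1 / 10000.
Proof.
move=> nk p; have -> : 1 / 10000 = (1 / 100) ^+ 2 :> R by field.
rewrite -[leLHS](sqr_sqrtr (cubic_normsq_ge0 p)) ler_pXn2r ?nnegrE ?sqrtr_ge0 //.
by apply: ltW; exact: nk.
Qed.

(** At a maximum, 16 w e^(-2u) + 2 e^u <= 2 forces e^u <= 1. At a minimum E = e^u satisfies 16 w /
    E^2 + 2 E >= 2, which also holds whenever E^2 <= 8 w; smallness gives 16 w <= E^3, hence 3 E >=
    2, and excludes that range. Then 16 w / E^2 <= 36/10000, whence E >= 1 - 18/10000. *)
Lemma solution_bounds : compact [set: S] -> is_solution h U u -> small h U u ->
  (forall p, cubic_norm h U p < 1 / 100) ->
  forall p, 1 - 18 / 10000 <= expR (u p) <= 1.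
Proof.
move=> cS sol sm nk p.
have cu : {within [set: S], continuous u}.
  by apply: continuous_subspaceT; apply: smooth_function_continuous; case: sol.
have w_ge0 := cubic_normsq_ge0.
have wk := cubic_normsq_le nk.
have S0 : [set: S] !=set0 by exists p.
have expm2 q : expR (- 2 * u q) = (expR (u q) ^+ 2)^-1.
  by rewrite -expRM_natl -expRN; congr expR; ring.
have [a _ amax] := compact_EVT_max S0 cS cu.
have [b _ bmin] := compact_EVT_min S0 cS cu.
apply/andP; split; last first.
  have ua : u p <= u a by apply: amax; rewrite inE.
  apply: (@le_trans _ _ (expR (u a))); first by rewrite ler_expR.
  have := @solution_at_extremum 1 a sol.
  rewrite !mul1r => H.
  have {H} : 16 * cubic_normsq h U a * expR (- 2 * u a) + 2 * expR (u a) - 2 <= 0.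
    by apply: H => q; rewrite !mul1r; apply: amax; rewrite inE.
  have : 0 <= 16 * cubic_normsq h U a * expR (- 2 * u a).
    by apply: mulr_ge0; [apply: mulr_ge0|exact: expR_ge0].
  by lra.
have ub : u b <= u p by apply: bmin; rewrite inE.
apply: (@le_trans _ _ (expR (u b))); last by rewrite ler_expR.
have H : 0 <= 16 * cubic_normsq h U b * expR (- 2 * u b) + 2 * expR (u b) - 2.
  have := @solution_at_extremum (-1) b sol.
  rewrite !mulN1r oppr_le0; apply => q.
  by rewrite !mulN1r lerN2; apply: bmin; rewrite inE.
set w := cubic_normsq h U b in H.
set E := expR (u b) in H *.
have E0 : 0 < E by exact: expR_gt0.
(* If w = 0 the inequality gives E >= 1 at once. Otherwise the premise of [small] holds and the
   logarithms below have positive arguments. *)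
have [w0|w0] := eqVneq w 0; first by move: H; rewrite w0; lra.
have w_pos : 0 < w by rewrite lt_neqAle eq_sym w0 w_ge0.
have w_sup : w <= sup (range (cubic_normsq h U)).
  apply: ub_le_sup; last by exists b.
  by exists (1 / 10000) => _ [q _ <-]; exact: wk.
have wE : 16 * w <= E ^+ 3.
  have smb : 3^-1 * ln (16 * sup (range (cubic_normsq h U))) <= u b.
    by apply: sm; exists b.
  have : ln (16 * w) <= 3 * u b.
    have : ln (16 * w) <= ln (16 * sup (range (cubic_normsq h U))).
      have sup0 := lt_le_trans w_pos w_sup.
      by rewrite ler_ln ?posrE; lra.
    by move: smb; lra.
  by rewrite -ler_expR expRM_natl lnK // posrE; lra.
rewrite expm2 -/E in H.
have E2 : 0 < E ^+ 2 by rewrite exprn_gt0.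
have E3 : 16 * w / E ^+ 2 <= E by rewrite ler_pdivrMr // -exprS.
have E23 : 2 / 3 <= E by lra.
have E4 : 4 / 9 <= E ^+ 2.
  have -> : 4 / 9 = (2 / 3) ^+ 2 :> R by field.
  by rewrite ler_pXn2r ?nnegrE //; lra.
have : 16 * w / E ^+ 2 <= 36 / 10000.
  rewrite ler_pdivrMr //; have := wk b; rewrite -/w; lra.
by lra.
Qed.

Lemma poincare_scale (cov : R[i] -> S) (z : R[i]) : is_uniformization h cov ->
  disc z ->
  let s := fun z => Num.sqrt (expR (u (cov z)) * lift_density h cov z / 2) in
  0 < s z /\ (s z * (1 - Normc.normc z ^+ 2)) ^+ 2 = 2 * expR (u (cov z)).
Proof.
move=> [_ _ iso] dz s.
have P0 : 0 < 1 - Normc.normc z ^+ 2 by rewrite subr_gt0 expr_lt1 ?normc_ge0.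
have l0 : 0 < expR (u (cov z)) * lift_density h cov z / 2.
  rewrite iso // /poincare_density divr_gt0 // mulr_gt0 ?expR_gt0 //.
  by rewrite divr_gt0 // exprn_gt0.
split; first by rewrite sqrtr_gt0.
rewrite exprMn sqr_sqrtr ?ltW // iso // /poincare_density; field.
by rewrite gt_eqF.
Qed.

Lemma cubic_bound (w E : R) : w <= 1 / 10000 -> 1 - 18 / 10000 <= E ->
  8 * w <= 27 / 10000 * E ^+ 3.
Proof.
move=> wk Ek.
have : (9 / 10) ^+ 3 <= E ^+ 3 by rewrite ler_pXn2r ?nnegrE //; lra.
by rewrite !exprS expr0; lra.
Qed.

(** With L the lifted density, |Q|^2 = w L^3 and s^2 = E L / 2, so that |q|^2 = (8 w / E^3) s^2,
    where w E^-3 is the squared norm of U for the metric e^u h. *)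
Lemma lift_coef_bound (cov : R[i] -> S) (z : R[i]) : is_uniformization h cov ->
  disc z -> cubic_normsq h U (cov z) <= 1 / 10000 ->
  1 - 18 / 10000 <= expR (u (cov z)) ->
  forall s, s = Num.sqrt (expR (u (cov z)) * lift_density h cov z / 2) ->
  Normc.normc (lift_coef U cov z * s%:C ^- 2) ^+ 2 <= 27 / 10000 * s ^+ 2.
Proof.
move=> [_ _ iso] dz wk Ek.
have P0 : 0 < 1 - Normc.normc z ^+ 2 by rewrite subr_gt0 expr_lt1 ?normc_ge0.
have L0 : 0 < lift_density h cov z.
  by rewrite iso // /poincare_density divr_gt0 // exprn_gt0.
set E := expR _ in Ek *; have E0 : 0 < E by exact: expR_gt0.
set L := lift_density h cov z in L0 *; move=> s sE.
have s2 : s ^+ 2 = E * L / 2 by rewrite sE sqr_sqrtr // ltW // divr_gt0 // mulr_gt0.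
pose i := chart_at X (cov z).
have d0 : 0 < density h i (chart_map i (cov z)).
  by apply: density_gt0; exists (cov z) => //; exact: chart_atP.
have l0 : 0 < Normc.normc (lift' X cov z).
  rewrite lt_neqAle normc_ge0 andbT eq_sym; apply/eqP => l0.
  by move: L0; rewrite /L /lift_density l0 expr0n mulr0 ltxx.
have QE : Normc.normc (lift_coef U cov z) ^+ 2 = cubic_normsq h U (cov z) * L ^+ 3.
  rewrite /lift_coef /cubic_normsq /L /lift_density -/i !exprS !expr0 !mulr1.
  rewrite !Normc.normcM; field.
  by rewrite gt_eqF.
have nV : Normc.normc (s%:C ^- 2) = (s ^+ 2)^-1.
  rewrite -rmorphXn -fmorphV normcE /= expr0n addr0 sqrtr_sqr ger0_norm //.
  by rewrite invr_ge0 sqr_ge0.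
rewrite Normc.normcM nV exprMn QE s2; set w := cubic_normsq _ _ _ in wk *.
have w0 : 0 <= w by exact: cubic_normsq_ge0.
have -> : w * L ^+ 3 * (E * L / 2)^-1 ^+ 2 = (8 * w / E ^+ 3) * (E * L / 2).
  by field; rewrite !gt_eqF.
apply: ler_wpM2r; first by rewrite !mulr_ge0 // ltW.
rewrite ler_pdivrMr ?exprn_gt0 //.
exact: cubic_bound.
Qed.

End Surface.

(** * The ball model of CH^2 and properness *)

Section BallModel.
Context {R : realType}.
Implicit Types (u v : 'cV[R[i]]_3) (z w : R[i]).

Lemma Re_herm_self u :
  Re (herm u u) = Normc.normc (u 0 0) ^+ 2 + Normc.normc (u 1 0) ^+ 2 -
    Normc.normc (u 2 0) ^+ 2.
Proof.
by rewrite /herm !normc_sqr ReD ReN ReD !ReM !ReJ !ImJ; ring.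
Qed.

Lemma Im_herm_self u : Im (herm u u) = 0.
Proof. by rewrite /herm ImD ImN ImD !ImM !ReJ !ImJ; ring. Qed.

Lemma WminusE u : Wminus u <->
  Normc.normc (u 0 0) ^+ 2 + Normc.normc (u 1 0) ^+ 2 < Normc.normc (u 2 0) ^+ 2.
Proof.
rewrite /Wminus /= ltcE Im_herm_self Re_herm_self /= eqxx /= subr_lt0.
by [].
Qed.

(** The chart that identifies CH^2 with the unit ball of C^2; the last coordinate has no zero on
    W_-. *)
Definition affine_coord u : R[i] * R[i] := (u 0 0 / u 2 0, u 1 0 / u 2 0).

Lemma Wminus_neq0 u : Wminus u -> u 2 0 != 0.
Proof.
move=> /WminusE h; apply/eqP => u0; move: h; rewrite u0 Normc.normc0 expr0n /=.
by rewrite ltNge addr_ge0 ?sqr_ge0.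
Qed.

Lemma affine_coord_same_line (a b : set_type (@Wminus R)) :
  same_line a b <-> affine_coord (\val a) = affine_coord (\val b).
Proof.
have a0 : (\val a) 2 0 != 0 by apply: Wminus_neq0; exact: set_mem (valP a).
have b0 : (\val b) 2 0 != 0 by apply: Wminus_neq0; exact: set_mem (valP b).
split=> [/asboolP[c c0 e]|].
  by rewrite /affine_coord e !mxE; congr (_, _); field; rewrite c0 b0.
move=> [e0 e1]; apply/asboolP; exists ((\val a) 2 0 / (\val b) 2 0).
  by rewrite mulf_neq0 ?invr_eq0.
apply/matrixP => i j; rewrite ord1 !mxE.
case: i => [[|[|[|//]]] hi].
- have -> : Ordinal hi = 0 by apply: val_inj.
  by rewrite -[LHS](divfK a0) e0; field.
- have -> : Ordinal hi = 1 by apply: val_inj.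
  by rewrite -[LHS](divfK a0) e1; field.
- have -> : Ordinal hi = 2 by apply: val_inj.
  by field.
Qed.

Lemma continuous_affine_coord u : u 2 0 != 0 -> {for u, continuous affine_coord}.
Proof.
move=> u0; apply: continuous_pair; apply: continuousM;
  try exact: matrix_normedtype.coord_continuous;
  by apply: continuousV => //; exact: matrix_normedtype.coord_continuous.
Qed.

(** [affine_coord] is constant on lines, so its value at a representative descends continuously to
    the quotient. Injective into a Hausdorff space, it allows limits in CH^2 to be identified in
    C^2. *)
Definition ball_coord (q : CH2 R) : R[i] * R[i] := affine_coord (\val (repr q)).

Lemma continuous_ball_coord : continuous ball_coord.
Proof.
apply: (@repr_comp_continuous _ ({eq_quot (@same_line R)})%qT _
  (fun a => affine_coord (\val a))).
  move=> a; apply: (@continuous_comp _ _ _ (fun a : set_type (@Wminus R) => \val a)).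
    exact: initial_continuous.
  by apply/continuous_affine_coord/Wminus_neq0/set_mem/(valP a).
move=> a b /eqP/eqquotP ab; apply/eqP.
exact/affine_coord_same_line.
Qed.

Lemma ball_coord_inj : injective ball_coord.
Proof.
move=> p q /affine_coord_same_line pq.
rewrite -(reprK p) -(reprK q); exact/eqquotP.
Qed.

Lemma ball_coord_proj u : Wminus u -> ball_coord (proj_class u) = affine_coord u.
Proof.
move=> Wu; rewrite /ball_coord /proj_class.
set x := insubd _ u.
have <- : \val x = u by rewrite insubdK //; exact: mem_set.
apply/affine_coord_same_line.
by apply/eqquotP; exact: reprK.
Qed.

Definition ball_norm (p : R[i] * R[i]) : R :=
  Normc.normc p.1 ^+ 2 + Normc.normc p.2 ^+ 2.

Lemma ball_norm_affine u : u 2 0 != 0 -> ball_norm (affine_coord u) =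
  (Normc.normc (u 0 0) ^+ 2 + Normc.normc (u 1 0) ^+ 2) / Normc.normc (u 2 0) ^+ 2.
Proof.
move=> u0; rewrite /ball_norm /affine_coord /= !Normc.normcM !Normc.normcV.
by rewrite !exprMn -mulrDl exprVn.
Qed.

Lemma ball_norm_lt1 (q : CH2 R) : ball_norm (ball_coord q) < 1.
Proof.
have W : Wminus (\val (repr q)) by exact: set_mem (valP (repr q)).
have h := Wminus_neq0 W; rewrite /ball_coord ball_norm_affine //.
have n0 : 0 < Normc.normc ((\val (repr q)) 2 0) ^+ 2.
  rewrite exprn_gt0 // lt_neqAle normc_ge0 andbT eq_sym.
  by apply: contra h => /eqP/Normc.eq0_normc ->.
by rewrite ltr_pdivrMr // mul1r; apply/WminusE.
Qed.

Lemma continuous_ball_norm : continuous ball_norm.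
Proof.
move=> p; have sq (f : R[i] * R[i] -> R[i]) : {for p, continuous f} ->
    {for p, continuous (fun a => Normc.normc (f a) ^+ 2)}.
  move=> cf; have -> : (fun a => Normc.normc (f a) ^+ 2) =
      (fun a => Re (f a) * Re (f a) + Im (f a) * Im (f a)).
    by apply/funext => a; rewrite normc_sqr !expr2.
  have cr : {for p, continuous (fun a => Re (f a))}.
    exact: (continuous_comp cf (@continuous_Re R (f p))).
  have ci : {for p, continuous (fun a => Im (f a))}.
    exact: (continuous_comp cf (@continuous_Im R (f p))).
  by apply: continuousD; apply: continuousM.
have c1 : {for p, continuous (fun a : R[i] * R[i] => a.1)} by exact: cvg_fst.
have c2 : {for p, continuous (fun a : R[i] * R[i] => a.2)} by exact: cvg_snd.
exact: (continuousD (sq _ c1) (sq _ c2)).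
Qed.

Lemma continuous_from_ReIm (f : R[i] -> R[i]) z :
  {for z, continuous (fun w => Re (f w))} ->
  {for z, continuous (fun w => Im (f w))} -> {for z, continuous f}.
Proof.
move=> cr ci; have -> : f = (fun w => (fun p : R * R => p.1 +i* p.2) (Re (f w), Im (f w))).
  by apply/funext => w /=; case: (f w).
apply: (@continuous_comp _ _ _ (fun w => (Re (f w), Im (f w)))
  (fun p : R * R => p.1 +i* p.2)).
  exact: continuous_pair.
exact: continuous_complex_pair.
Qed.

(* A continuous map of the disc to CH^2 given by vectors of square -1 whose last
   coordinate tends to infinity at the boundary is proper. *)
Lemma proper_of_growth (f : R[i] -> 'cV[R[i]]_3) (C : R) :
  (forall z, disc z -> herm (f z) (f z) = -1) ->
  (forall i z, disc z -> {for z, continuous (fun w => f w i 0)}) ->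
  (forall z, disc z ->
     - ln (1 - Normc.normc z) <= 4 * (Normc.normc (f z 2 0) ^+ 2 + C)) ->
  proper_on (@disc R) (fun z => proj_class (f z)).
Proof.
move=> hf cf growth K cK.
pose g z := proj_class (f z).
have Wf z : disc z -> Wminus (f z).
  by move=> dz; rewrite /Wminus /= hf // oppr_lt0 ltr01.
have gE z : disc z -> ball_coord (g z) = affine_coord (f z).
  by move=> dz; exact: ball_coord_proj (Wf z dz).
have [[q0 q0K]|K0] := pselect (K !=set0); last first.
  have -> : disc `&` g @^-1` K = set0; last exact: compact0.
  by rewrite -subset0 => z [_ gz]; apply: K0; exists (g z).
(* The maximum m over K is less than 1. As <f, f> = -1, the ball norm of [f] is 1 - 1/|f_3|^2, so
   |f_3|^2 <= 1 / (1 - m) wherever [f] lies in K. *)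
have [||q qK qmax] := @compact_EVT_max _ R (fun q => ball_norm (ball_coord q)) K _ cK _.
- by exists q0.
- apply: continuous_subspaceT => p.
  apply: (@continuous_comp _ _ _ ball_coord ball_norm).
    exact: continuous_ball_coord.
  exact: continuous_ball_norm.
set m := ball_norm (ball_coord q) in qmax.
have m1 : 0 < 1 - m by rewrite subr_gt0 ball_norm_lt1.
(* The growth hypothesis then gives -ln (1 - |z|) <= B, that is, |z| <= r0 < 1. *)
pose B := 4 * ((1 - m)^-1 + C).
pose r0 := 1 - expR (- B).
have r0_lt1 : r0 < 1 by rewrite /r0 ltrBlDr ltrDl expR_gt0.
have inner z : disc z -> K (g z) -> Normc.normc z <= r0.
  move=> dz Kz; have f0 := Wminus_neq0 (Wf z dz).
  have := qmax (g z) (mem_set Kz); rewrite gE // ball_norm_affine //.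
  have := congr1 (@complex.Re R) (hf z dz); rewrite Re_herm_self /=.
  set a := Normc.normc (f z 0 0) ^+ 2; set b := Normc.normc (f z 1 0) ^+ 2.
  have n0 : 0 < Normc.normc (f z 2 0) ^+ 2.
    rewrite exprn_gt0 // lt_neqAle normc_ge0 andbT eq_sym.
    by apply: contra f0 => /eqP/Normc.eq0_normc ->.
  set c := Normc.normc (f z 2 0) ^+ 2 in n0 *.
  move=> abc; have -> : a + b = c - 1 by lra.
  rewrite ler_pdivrMr // => cm.
  have c_le : c <= (1 - m)^-1.
    by rewrite -[(1 - m)^-1]mul1r ler_pdivlMr //; lra.
  have := growth z dz; rewrite -/c => gr.
  have n1 : 0 < 1 - Normc.normc z by rewrite subr_gt0.
  have : - B <= ln (1 - Normc.normc z) by rewrite lerNl (le_trans gr) // /B; lra.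
  by rewrite -ler_expR lnK ?posrE // /r0; lra.
(* A compact set containing the disc; the preimage of K remains to be shown closed in it. *)
pose sq : set R[i] := (fun p : R * R => p.1 +i* p.2) @`
  (`[-1, 1]%classic `*` `[-1, 1]%classic).
have csq : compact sq.
  apply: continuous_compact.
    by apply: continuous_subspaceT => -[x y]; exact: continuous_complex_pair.
  by apply: compact_setX; exact: segment_compact.
apply: (subclosed_compact _ csq); last first.
  move=> z [dz _]; exists (Re z, Im z); last by case: (z).
  have n1 : Normc.normc z <= 1 by exact: ltW.
  have bound (a : R) : a ^+ 2 <= Normc.normc z ^+ 2 -> -1 <= a <= 1.
    move=> an; rewrite -ler_norml -(@expr_le1 _ 2) ?normr_ge0 //.
    rewrite real_normK ?num_real //; apply: le_trans an _.
    by rewrite expr_le1 ?normc_ge0.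
  by split; rewrite /= in_itv /=; apply: bound; rewrite normc_sqr
    ?lerDl ?lerDr ?sqr_ge0.
move=> z clz.
have zr0 : Normc.normc z <= r0.
  rewrite leNgt; apply/negP => rz.
  have [|w [[dw Kw] hw]] := clz [set w | Normc.normc (w - z) < Normc.normc z - r0].
    by apply/nbhs_normc; exists (Normc.normc z - r0); rewrite ?subr_gt0.
  have := normcD (z - w) w; rewrite subrK -opprB normcN /= => h.
  have := inner w dw Kw; rewrite /= in hw; lra.
have dz : disc z by apply: le_lt_trans zr0 r0_lt1.
split=> //.
have ca : {for z, continuous (fun w => affine_coord (f w))}.
  have f0 := Wminus_neq0 (Wf z dz).
  have c i : {for z, continuous (fun w => f w i 0)} by exact: cf.
  have cV : {for z, continuous (fun w => (f w 2 0)^-1)}.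
    exact: (@continuousV _ _ (fun w => f w 2 0) z f0 (c 2)).
  have c0 : {for z, continuous (fun w => f w 0 0 / f w 2 0)}.
    exact: (@continuousM _ _ (fun w => f w 0 0) (fun w => (f w 2 0)^-1) z (c 0) cV).
  have c1 : {for z, continuous (fun w => f w 1 0 / f w 2 0)}.
    exact: (@continuousM _ _ (fun w => f w 1 0) (fun w => (f w 2 0)^-1) z (c 1) cV).
  exact: (continuous_pair c0 c1).
(* The limit point is handled in ball coordinates, where the compact image of K is closed;
   injectivity brings it back to K. *)
have clK : closed (ball_coord @` K).
  apply: compact_closed; first exact: norm_hausdorff.
  apply: continuous_compact; last exact: cK.
  by apply: continuous_subspaceT; exact: continuous_ball_coord.
have : (ball_coord @` K) (affine_coord (f z)).
  apply: contrapT => nK.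
  have nb : nbhs (affine_coord (f z)) (~` (ball_coord @` K)).
    by apply: open_nbhs_nbhs; split => //; exact: closed_openC.
  have nd : nbhs z (@disc R).
    by apply: open_nbhs_nbhs; split => //; exact: open_disc.
  have [w [[dw Kw] [dw' hw]]] := clz _ (filterI nd (ca _ nb)).
  by apply: hw; exists (g w) => //; exact: gE.
move=> [p Kp pE].
have pg : p = g z by apply: ball_coord_inj; rewrite gE.
by rewrite /preimage /= -/(g z) -pg.
Qed.

End BallModel.

Theorem proposition8p1 (R : realType) :
  exists2 k : R, 0 < k &
  forall (S : topologicalType) (X : riemannSurface R S)
    (h : conformalMetric X) (U : cubicDifferential X) (u : S -> R)
    (cov : R[i] -> S) (F : R[i] -> 'M[R[i]]_3),
    compact [set: S] ->
    has_curvature h (- 1) ->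
    is_solution h U u ->
    small h U u ->
    is_uniformization h cov ->
    associated_frame h U u cov F ->
    (forall p : S, cubic_norm h U p < k) ->
    proper_on (@disc R) (immersion_of_frame F).
Proof.
(* A convenient value: it keeps the error in [flux_derivative_lower] below 3/10 of S |a2|^2, where
   anything up to S |a2|^2 could be absorbed. *)
exists (1 / 100); first by rewrite divr_gt0.
move=> S X h U u cov F cS _ sol sm unif frameF nk.
have Eu := solution_bounds cS sol sm nk.
pose s z := Num.sqrt (expR (u (cov z)) * lift_density h cov z / 2).
have s_gt0 z : disc z -> 0 < s z by move=> dz; have [] := poincare_scale u unif dz.
have s_bounds x y : disc (Complex x y) ->
    2 * (1 - 18 / 10000) <= (s (Complex x y) * (1 - (x * x + y * y))) ^+ 2 <= 2.
  move=> dz; have [_] := poincare_scale u unif dz.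
  rewrite normc_sqr /= !expr2 -/(s _) => ->.
  by have /andP[? ?] := Eu (cov (Complex x y)); apply/andP; split; lra.
have Q_bound z : disc z -> Normc.normc
    (lift_coef U cov z * (real_complex R (s z)) ^- 2) ^+ 2 <= 27 / 10000 * s z ^+ 2.
  move=> dz; have /andP[Ek _] := Eu (cov z).
  exact: (lift_coef_bound unif dz (cubic_normsq_le nk (cov z)) Ek).
have angular := angular_derivative_bound s_gt0 frameF s_bounds Q_bound.
apply: (@proper_of_growth R (fun z => col 2 (F z)) (Normc.normc (F 0 2 2) ^+ 2)).
- move=> z dz; have [SU _ _ _] := frameF; have [_ H] := SU z dz.
  rewrite !colE H /herm !mxE /= !(rmorph0, rmorph1) /=; ring.
- move=> i z dz; have -> : (fun w => col 2 (F w) i 0) = (fun w => F w i 2).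
    by apply/funext => w; rewrite mxE.
  have [_ sF _ _] := frameF; have [s1 s2] := sF i 2.
  by apply: continuous_from_ReIm; apply: smooth_continuous dz.
- move=> z dz; rewrite mxE.
  exact: (last_entry_growth s_gt0 frameF angular Q_bound dz).
Qed.
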